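(* Let $a,b$ be real numbers with $0<b<a-1$. Then the function $F_{a,b}$ on $(0,\infty)$ defined by $$F_{a,b}(x)=\frac{x^{a-b-1}}{\psi(x+a)-\psi(x+b)}$$ belongs to $\mathcal B_{a-b}$.
   Context: Here $\psi(x)=(\log\Gamma)'(x)$ is the logarithmic derivative of the Gamma function. A function $g:(0,\infty)\to\mathbb R$ is completely monotonic if it is infinitely often differentiable and $(-1)^n g^{(n)}(x)\ge 0$ for all $n=0,1,2,\ldots$ and all $x>0$. For $\lambda>0$, a $C^\infty$-function $f:(0,\infty)\to(0,\infty)$ belongs to the class $\mathcal B_\lambda$ of generalized Bernstein functions of order $\lambda$ if $x\mapsto x^{1-\lambda}f'(x)$ is completely monotonic. *)

(* Defs.v *)
From HB Require Import structures.
From mathcomp Require Import all_boot all_order all_algebra.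
From mathcomp Require Import all_classical all_reals all_analysis.

Set Implicit Arguments.
Unset Strict Implicit.
Unset Printing Implicit Defensive.

Import Order.TTheory GRing.Theory Num.Theory.
Import numFieldNormedType.Exports.

Local Open Scope classical_set_scope.
Local Open Scope ring_scope.

(* Euler's integral; only meaningful for 0 < x (a divergent integral has a
   junk value), which is where it is used. *)
Definition Gamma {R : realType} (x : R) : R :=
  \int[@lebesgue_measure R]_(t in `]0, +oo[) (t `^ (x - 1) * expR (- t)).

Definition digamma {R : realType} : R -> R :=
  derive1 (fun x : R => ln (Gamma x)).

(* Functions on (0, oo) are total functions on R whose values outside
   (0, oo) are ignored: as (0, oo) is open, the iterated derivatives at
   0 < x only depend on the values on (0, oo). *)
Definition smooth_on_pos {R : realType} (g : R -> R) : Prop :=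
  forall (n : nat) (x : R), 0 < x -> derivable (derive1n n g) x 1.

Definition completely_monotonic {R : realType} (g : R -> R) : Prop :=
  smooth_on_pos g /\
  forall (n : nat) (x : R), 0 < x -> 0 <= (-1) ^+ n * derive1n n g x.

Definition generalized_Bernstein {R : realType} (lambda : R) (f : R -> R)
    : Prop :=
  [/\ forall x : R, 0 < x -> 0 < f x,
      smooth_on_pos f &
      completely_monotonic (fun x : R => x `^ (1 - lambda) * derive1 f x)].

Definition F_ab {R : realType} (a b x : R) : R :=
  x `^ (a - b - 1) / (digamma (x + a) - digamma (x + b)).

(* Main.v *)
Require Import Defs.
From mathcomp Require Import all_boot all_order all_algebra.
From mathcomp Require Import all_classical all_reals all_analysis.
From mathcomp Require Import measurable_realfun ring lra.

Import Order.TTheory GRing.Theory Num.Theory.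
Import numFieldNormedType.Exports.

Local Open Scope classical_set_scope.
Local Open Scope ring_scope.

(**
Write lambda = a - b > 1 and g(x) = psi(x + a) - psi(x + b), so that
F_{a,b}(x) = x^(lambda - 1) / g(x) and
[[
  x^(1 - lambda) F'(x) = (lambda - 1) (1/g)(x) / x + (1/g)'(x).
]]
It therefore suffices that 1/g is a Bernstein function: then (1/g)' is
completely monotonic, and so is (1/g)(x)/x; the condition lambda > 1 gives the
first term the right sign.

Why 1/g is Bernstein. Put c_n(x) = (-1)^n g^(n)(x) / n!, and let v_n(x) be the
same normalized derivatives of 1/g.  Leibniz' rule says that, for each fixed x,
sum_k v_k c_{n-k} is 1 for n = 0 and 0 for n > 0, i.e. the sequences v and c are
inverse for convolution.  Kaluza's classical lemma ([kaluza]) then yields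
v_n <= 0 for n >= 1 as soon as c is positive and log-convex in n, and that sign
is exactly the complete monotonicity of (1/g)'.  The decay c_n = O(x^(-n))
moreover upgrades log-convexity to x c_{n+1} <= c_n ([log_convex_decay]), which
makes the convolution of v with the normalized derivatives x^(-n-1) of 1/x
nonnegative ([inverse_partial_sum_ge0]).

Why c_n(x) is log-convex in n. One has
c_n(x) = sum_k ((x + b + k)^(-n-1) - (x + a + k)^(-n-1)), hence
[[
  n! c_n(x) = int_0^oo t^n f(t) dt,
  f(t) = e^(-(x+b) t) (1 - e^(-lambda t)) / (1 - e^(-t)).
]]
For lambda >= 1 the density f is log-convex, because sinh(lambda t) >= lambda
sinh(t).  For a pure exponential, t^n / n! has geometric moments.  If
log-convexity of c failed at n, an exponential A e^(-c t) could be squeezed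
between the three moments concerned; but f - A e^(-c t) changes sign at most
twice, in the pattern +,-,+, so a suitable quadratic (or linear) multiplier
contradicts the moment inequalities ([log_convex_moments]).

The identification of g with the series starts from Euler's integral.
Integration by parts gives Gamma(x + 1) = x Gamma(x), and weighted AM-GM under
the integral gives Gamma(x + h) <= x^h Gamma(x) for 0 <= h <= 1
([lnGamma_slope_le]).  These two facts force the slopes of ln Gamma at x + n to
approach ln(x + n), whence psi(x) = lim (ln(x + n) - sum_{k<n} 1/(x + k))
([digamma_cvg]).  All term-by-term differentiations rest on one lemma
([is_derive_limit]), which only asks for a uniform bound on second derivatives.
*)

(** * Kaluza's lemma *)

Lemma log_convex_ratio {R : realFieldType} (c : nat -> R) :
  (forall n, 0 < c n) -> (forall n, c n.+1 ^+ 2 <= c n * c n.+2) ->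
  forall m k, c m.+1 / c m <= c (m + k).+1 / c (m + k)%N.
Proof.
move=> c0 cc m; elim=> [|k IH]; first by rewrite addn0.
apply: le_trans IH _; rewrite addnS ler_pdivrMr// mulrAC ler_pdivlMr//.
by rewrite -expr2 [leRHS]mulrC.
Qed.

(** Kaluza's lemma. If [v] inverts a log-convex sequence [c], the relations of
    orders n and n+1 combine into an expression for [v n.+1 * c 0 * c n] as a sum
    of earlier [v k] against differences of the ratios [c m.+1 / c m], whose
    monotonicity settles the sign by strong induction. *)
Lemma kaluza {R : realFieldType} (c v : nat -> R) :
  (forall n, 0 < c n) -> (forall n, c n.+1 ^+ 2 <= c n * c n.+2) ->
  v 0%N * c 0%N = 1 ->
  (forall n, \sum_(k < n.+2) v k * c (n.+1 - k)%N = 0) ->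
  forall n, v n.+1 <= 0.
Proof.
move=> c0 cc v0 vc n; have [m] := ubnP n; elim: m n => // m IH [|n] nm.
  have := vc 0%N; rewrite !big_ord_recr big_ord0/= add0r subn0 subnn => e.
  rewrite -(pmulr_lle0 _ (c0 0%N)) -(addKr (v 0%N * c 1%N) (v 1%N * _)) e addr0.
  rewrite oppr_le0; apply: mulr_ge0; last exact: ltW.
  by rewrite -(pmulr_lge0 _ (c0 0%N)) v0.
rewrite -(pmulr_lle0 _ (c0 0%N)) -(pmulr_lle0 _ (c0 n.+1)).
have e1 := vc n.+1; have e0 := vc n.
rewrite big_ord_recr/= subnn in e1.
(* Eliminate [v n.+2] by the relation of order n+2, and subtract [c n.+2]
   times the vanishing relation of order n+1. *)
have -> : v n.+2 * c 0%N * c n.+1 =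
   \sum_(k < n.+2) v k * (c (n.+1 - k)%N * c n.+2 - c (n.+2 - k)%N * c n.+1).
  move/eqP: e1; rewrite addrC addr_eq0 => /eqP ->.
  under [RHS]eq_bigr do rewrite mulrBr !mulrA.
  by rewrite sumrB -!mulr_suml e0 mul0r sub0r mulNr.
rewrite big_ord_recl/= !subn0 mulrC [_ * c n.+2]mulrC subrr mul0r add0r.
apply: sumr_le0 => i _; rewrite /bump/= add1n.
have ltin := ltn_ord i.
apply: mulr_le0_ge0; first by apply: IH; exact: leq_trans ltin nm.
rewrite subr_ge0 !subSS.
have := log_convex_ratio c c0 cc (n - i) i.+1.
rewrite addnS subnK; last by rewrite -ltnS.
rewrite ler_pdivrMr// mulrAC ler_pdivlMr// subSn; last by rewrite -ltnS.
by rewrite [X in _ <= X -> _]mulrC.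
Qed.

(** The ratios [c n.+1 / c n] increase; were one of them larger than [1 / x], the
    sequence [c n * x ^+ n] would grow geometrically from there on. *)
Lemma log_convex_decay {R : archiRealFieldType} (c : nat -> R) (x C : R) :
  0 < x -> (forall n, 0 < c n) -> (forall n, c n.+1 ^+ 2 <= c n * c n.+2) ->
  (forall n, c n * x ^+ n <= C) -> forall n, x * c n.+1 <= c n.
Proof.
move=> x0 c0 cc cC m; rewrite leNgt; apply/negP => h.
pose q := x * (c m.+1 / c m).
have q1 : 1 < q by rewrite /q mulrA ltr_pdivlMr// mul1r.
have grow k : c m * x ^+ m * q ^+ k <= c (m + k)%N * x ^+ (m + k).
  elim: k => [|k IH]; first by rewrite expr0 mulr1 addn0.
  rewrite addnS exprSr mulrA [X in _ <= _ * X]exprSr.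
  apply: (@le_trans _ _ (c (m + k)%N * x ^+ (m + k) * q)).
    by rewrite ler_pM2r// (lt_trans _ q1).
  have := log_convex_ratio c c0 cc m k; rewrite ler_pdivlMr// => hk.
  have -> : c (m + k)%N * x ^+ (m + k) * q =
    c m.+1 / c m * c (m + k)%N * (x ^+ (m + k) * x) by rewrite /q; ring.
  by rewrite ler_pM2r// mulr_gt0// exprn_gt0.
have p0 : 0 < c m * x ^+ m by rewrite mulr_gt0// exprn_gt0.
have bern k : 1 + k%:R * (q - 1) <= q ^+ k.
  elim: k => [|k IH]; first by rewrite mul0r addr0 expr0.
  have -> : 1 + k.+1%:R * (q - 1) = 1 + k%:R * (q - 1) + (q - 1) by ring.
  rewrite exprS -[X in _ <= X * _](subrK 1) mulrDl mul1r [leRHS]addrC lerD//.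
  by apply: ler_peMr; rewrite ?subr_ge0 ?exprn_ege1// ltW.
(* Bernoulli's inequality turns geometric growth into unbounded growth. *)
pose z := C / (c m * x ^+ m) / (q - 1).
have := archi_boundP (normr_ge0 z); set k := Num.bound _ => hk.
have := le_trans (grow k) (cC (m + k)%N); apply/negP; rewrite -ltNge.
apply: lt_le_trans (ler_wpM2l (ltW p0) (bern k)).
rewrite mulrC -ltr_pdivrMr// ltr_wpDl// -ltr_pdivrMr ?subr_gt0//.
exact: le_lt_trans (ler_norm _) hk.
Qed.

(** The sign condition for [u(x) / x] when [u = 1 / g]. Since [v k <= 0] for
    k > 0 and [c (n - k) >= x ^+ k * c n], the vanishing convolution bounds
    [c n * \sum_k v k * x ^+ k] below by 0. *)
Lemma inverse_partial_sum_ge0 {R : realFieldType} (c v : nat -> R) (x : R) :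
  0 < x -> (forall n, 0 < c n) -> (forall n, x * c n.+1 <= c n) ->
  v 0%N * c 0%N = 1 -> (forall n, v n.+1 <= 0) ->
  (forall n, \sum_(k < n.+2) v k * c (n.+1 - k)%N = 0) ->
  forall n, 0 <= \sum_(k < n.+1) v k * x^-1 ^+ (n - k).+1.
Proof.
move=> x0 c0 cx v0 vn vc n.
have cxk m k : x ^+ k * c (m + k)%N <= c m.
  elim: k => [|k IH]; first by rewrite expr0 mul1r addn0.
  by apply: le_trans IH; rewrite exprSr -mulrA addnS ler_pM2l ?exprn_gt0.
have v00 : 0 <= v 0%N by rewrite -(pmulr_lge0 _ (c0 0%N)) v0.
have h : 0 <= \sum_(k < n.+1) v k * x ^+ k.
  case: n => [|n]; first by rewrite big_ord1 expr0 mulr1.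
  rewrite -(pmulr_lge0 _ (c0 n.+1)) mulr_suml -[X in X <= _](vc n).
  apply: ler_sum => -[[|k] /= kn] _; first by rewrite subn0 expr0 mulr1.
  rewrite -mulrA; apply: ler_wnM2l; first exact: vn.
  by have := cxk (n.+1 - k.+1)%N k.+1; rewrite subnK.
rewrite -(pmulr_lge0 _ (exprn_gt0 n.+1 x0)) mulr_suml (le_trans h)//.
rewrite le_eqVlt; apply/orP; left; apply/eqP; apply: eq_bigr => -[k kn] _ /=.
rewrite -mulrA; congr (_ * _); rewrite exprVn.
have -> : n.+1 = ((n - k).+1 + k)%N by rewrite addSn subnK.
by rewrite exprD mulrA mulVf ?mul1r// expf_neq0// gt_eqF.
Qed.

(** * Signed jets *)

(** [c n] plays the role of (-1)^n f^(n) / n! for f = [c 0]. With this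
    normalization Leibniz' rule becomes plain convolution, and complete
    monotonicity becomes nonnegativity of all [c n]. *)
Definition signed_jet {R : realType} (c : nat -> R -> R) :=
  forall (n : nat) (x : R), 0 < x -> is_derive x 1 (c n) (- (n.+1%:R * c n.+1 x)).

Lemma near_pos {R : realType} (P : R -> Prop) (x : R) :
  (forall y, 0 < y -> P y) -> 0 < x -> \forall y \near x, P y.
Proof. by move=> PP x0; near=> y; apply: PP; near: y; exact: lt_nbhsr. Unshelve. all: by end_near. Qed.

Lemma is_derive_eq_pos {R : realType} (f g : R -> R) (x df : R) :
  (forall y, 0 < y -> f y = g y) -> 0 < x ->
  is_derive x 1 f df -> is_derive x 1 g df.
Proof.
move=> fg x0; apply: near_eq_is_derive.
exact: near_pos.
Qed.

(** Only values on the positive half-line matter, as it is open; this is how the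
    total functions of the statement are replaced by convenient formulas. *)
Lemma signed_jet_derive1n {R : realType} (c : nat -> R -> R) (f : R -> R) :
  signed_jet c -> (forall x, 0 < x -> f x = c 0%N x) ->
  forall n x, 0 < x ->
    derivable (derive1n n f) x 1 /\
    (-1) ^+ n * derive1n n f x = n`!%:R * c n x.
Proof.
move=> jc fc.
have E n : forall x, 0 < x -> derive1n n f x = (-1) ^+ n * n`!%:R * c n x /\
   is_derive x 1 (derive1n n f) ((-1) ^+ n.+1 * n.+1`!%:R * c n.+1 x).
  elim: n => [|n IH].
    move=> x x0; rewrite derive1n0 expr0 fact0 !mul1r fc//; split=> //.
    have := jc 0%N x x0; rewrite mul1r expr1 factS fact0 muln1 mulr1 mulN1r.
    by apply: is_derive_eq_pos => // y y0; rewrite fc.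
  have E1 x : 0 < x ->
      derive1n n.+1 f x = (-1) ^+ n.+1 * n.+1`!%:R * c n.+1 x.
    by move=> x0; rewrite derive1nS derive1E; have [_ [_ ->]] := IH x x0.
  move=> x x0; split; first exact: E1.
  have := @is_deriveZ _ _ _ _ ((-1) ^+ n.+1 * n.+1`!%:R) _ _ _ (jc n.+1 x x0).
  move=> /(is_derive_eq_pos _ (derive1n n.+1 f) x _ _ x0) h.
  apply: is_derive_eq; first by apply: h => y y0; rewrite E1.
  rewrite [in RHS]factS natrM [in RHS]exprS /GRing.scale/=; ring.
move=> n x x0; have [-> [d _]] := E n x x0; split=> //.
by rewrite !mulrA -expr2 sqrr_sign mul1r.
Qed.

(** The Euler operator n x_n is a derivation for convolution; this is Leibniz'
    rule in normalized form. *)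
Lemma conv_euler {R : comNzRingType} (c d : nat -> R) (n : nat) :
  \sum_(k < n.+1) (k.+1%:R * c k.+1 * d (n - k)%N +
                   c k * ((n - k).+1%:R * d (n - k).+1)) =
  n.+1%:R * \sum_(k < n.+2) c k * d (n.+1 - k)%N.
Proof.
rewrite big_split/= mulr_sumr.
rewrite [RHS](eq_bigr (fun k : 'I_n.+2 => k%:R * c k * d (n.+1 - k)%N +
    c k * ((n.+1 - k)%:R * d (n.+1 - k)%N))); last first.
  move=> [k /= kn] _.
  have -> : (n.+1%:R : R) = k%:R + (n.+1 - k)%:R by rewrite -natrD subnKC// -ltnS.
  by ring.
rewrite [RHS]big_split/=; congr (_ + _).
  by rewrite [RHS]big_ord_recl/= !mul0r add0r; apply: eq_bigr.
rewrite [RHS]big_ord_recr/= subnn mul0r mulr0 addr0; apply: eq_bigr => -[k /= kn] _.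
by rewrite subSn.
Qed.

Lemma is_derive_conv {R : realType} (c d : nat -> R -> R) (m n : nat) (x : R) :
  (forall k, (k < m)%N -> is_derive x 1 (c k) (- (k.+1%:R * c k.+1 x))) ->
  (forall k, is_derive x 1 (d k) (- (k.+1%:R * d k.+1 x))) ->
  is_derive x 1 (fun y => \sum_(k < m) c k y * d (n - k)%N y)
    (- \sum_(k < m) (k.+1%:R * c k.+1 x * d (n - k)%N x +
                     c k x * ((n - k).+1%:R * d (n - k).+1 x))).
Proof.
move=> jc jd.
have h (k : 'I_m) : is_derive x 1 (c k \* d (n - k)%N)
   (c k x * (- ((n - k).+1%:R * d (n - k).+1 x)) + d (n - k)%N x * (- (k.+1%:R * c k.+1 x))).
  by apply: is_deriveM; exact: jc.
have := is_derive_sum h.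
have -> : \sum_(i < m) (c i \* d (n - i)%N) =
   (fun y => \sum_(k < m) c k y * d (n - k)%N y).
  by apply/funext => y; rewrite fct_sumE.
move=> H; apply: is_derive_eq; rewrite -sumrN.
by apply: eq_bigr => k _; ring.
Qed.

Lemma signed_jet_conv {R : realType} (c d : nat -> R -> R) :
  signed_jet c -> signed_jet d ->
  signed_jet (fun n x => \sum_(k < n.+1) c k x * d (n - k)%N x).
Proof.
move=> jc jd n x x0; rewrite -(conv_euler (c ^~ x) (d ^~ x)).
exact: (is_derive_conv c d n.+1 n x (fun k _ => jc k x x0) (fun k => jd k x x0)).
Qed.

(** The inverse for convolution is defined by a course-of-values recursion, so
    the list of all earlier values is carried along. *)
Fixpoint conv_inverse_prefix {R : fieldType} (c : nat -> R) (n : nat) : seq R :=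
  if n is m.+1 then
    let s := conv_inverse_prefix c m in
    rcons s (- (\sum_(k < m.+1) s`_k * c (m.+1 - k)%N) / c 0%N)
  else [:: (c 0%N)^-1].

Definition conv_inverse {R : fieldType} (c : nat -> R) (n : nat) : R :=
  (conv_inverse_prefix c n)`_n.

Lemma conv_inverseS {R : fieldType} (c : nat -> R) (n : nat) :
  conv_inverse c n.+1 =
  - (\sum_(k < n.+1) conv_inverse c k * c (n.+1 - k)%N) / c 0%N.
Proof.
have sz m : size (conv_inverse_prefix c m) = m.+1.
  by elim: m => //= m IH; rewrite size_rcons IH.
have pre m k : (k <= m)%N -> (conv_inverse_prefix c m)`_k = conv_inverse c k.
  elim: m => [|m IH]; first by rewrite leqn0 => /eqP ->.
  rewrite leq_eqVlt => /predU1P[-> //|km].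
  by rewrite /= nth_rcons sz km IH.
rewrite {1}/conv_inverse/= nth_rcons sz ltnn eqxx; congr (- _ / _).
by apply: eq_bigr => k _; rewrite pre// -ltnS.
Qed.

Lemma conv_inverse0 {R : fieldType} (c : nat -> R) :
  c 0%N != 0 -> conv_inverse c 0%N * c 0%N = 1.
Proof. by move=> c0; rewrite mulVf. Qed.

Lemma conv_inverseP {R : fieldType} (c : nat -> R) (n : nat) : c 0%N != 0 ->
  \sum_(k < n.+2) conv_inverse c k * c (n.+1 - k)%N = 0.
Proof.
by move=> c0; rewrite big_ord_recr/= subnn conv_inverseS divfK// subrr.
Qed.

(** The jet of 1/f: the recursion defining the inverse sequence is differentiated
    and compared, through [conv_euler], with the same recursion one step later. *)
Lemma signed_jet_inverse {R : realType} (c : nat -> R -> R) :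
  signed_jet c -> (forall x, 0 < x -> c 0%N x != 0) ->
  signed_jet (fun n x => conv_inverse (c ^~ x) n).
Proof.
move=> jc c0 n; have [m] := ubnP n; elim: m n => // m IH [|n] nm x x0.
  have c0x := c0 x x0.
  have H := @is_deriveV _ _ _ _ _ c0x (jc 0%N x x0).
   apply: is_derive_eq.
  rewrite conv_inverseS big_ord1 /conv_inverse/= /GRing.scale/=.
  by field.
have c0x := c0 x x0.
pose v k y := conv_inverse (c ^~ y) k; pose P y := \sum_(k < n.+1) v k y * c (n.+1 - k)%N y.
have vE y : v n.+1 y = - P y / c 0%N y by rewrite /v conv_inverseS.
rewrite -/(v n.+1) (_ : v n.+1 = fun y => - P y / c 0%N y); last exact/funext.
have dP : is_derive x 1 P (n.+2%:R * v n.+2 x * c 0%N x + v n.+1 x * c 1%N x).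
  have h k : (k < n.+1)%N -> is_derive x 1 (v k) (- (k.+1%:R * v k.+1 x)).
    by move=> kn; apply: IH => //; exact: leq_trans kn nm.
  have := is_derive_conv v c n.+1 n.+1 x h (fun k => jc k x x0) => H.
  apply: is_derive_eq.
  have := conv_euler (v ^~ x) (c ^~ x) n.+1.
  rewrite conv_inverseP// mulr0 big_ord_recr/= subnn => /eqP.
  rewrite addr_eq0 => /eqP ->; ring.
have dV := @is_deriveV _ _ _ _ _ c0x (jc 0%N x x0).
have := @is_deriveM _ _ _ _ _ _ _ _ (@is_deriveN _ _ _ _ _ _ _ dP) dV.
move=> H; apply: is_derive_eq.
have -> : (- P) x = v n.+1 x * c 0%N x by rewrite vE divfK.
by rewrite /GRing.scale/= -/(v n.+2 x); field.
Qed.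

(** * Differentiating a limit *)

Lemma MVT_ball {R : realType} (f df : R -> R) (x y r : R) :
  (forall z, `|z - x| < r -> is_derive z 1 f (df z)) -> `|y - x| < r ->
  exists2 c, `|c - x| <= `|y - x| & f y - f x = df c * (y - x).
Proof.
move=> dfz yr.
have cont a b : (forall z, z \in `[a, b] -> `|z - x| < r) ->
    {within `[a, b], continuous f}.
  move=> ab; apply: derivable_within_continuous => z zab.
  by have [] := dfz z (ab z zab).
have [xy|yx] := leP x y.
  have sub z : z \in `[x, y] -> `|z - x| <= `|y - x|.
    by rewrite in_itv/= => /andP[xz zy]; rewrite !ger0_norm ?subr_ge0// lerD2r.
  have subr z : z \in `[x, y] -> `|z - x| < r by move=> /sub zx; exact: le_lt_trans yr.
  have [||c cxy ->] := @MVT_segment R f df x y xy.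
  - by move=> z zxy; apply: dfz; apply: subr; exact: subset_itv_oo_cc zxy.
  - exact: cont.
  by exists c => //; exact: sub.
have sub z : z \in `[y, x] -> `|z - x| <= `|y - x|.
  rewrite in_itv/= => /andP[xz zy].
  rewrite (ler0_norm (_ : z - x <= 0)) ?subr_le0//.
  by rewrite (ltr0_norm (_ : y - x < 0)) ?subr_lt0// lerN2 lerD2r.
have subr z : z \in `[y, x] -> `|z - x| < r by move=> /sub zx; exact: le_lt_trans yr.
have [||c cxy e] := @MVT_segment R f df y x (ltW yx).
- by move=> z zxy; apply: dfz; apply: subr; exact: subset_itv_oo_cc zxy.
- exact: cont.
exists c; first exact: sub.
by rewrite -[LHS]opprB e -mulrN opprB.
Qed.

Lemma taylor1_bound {R : realType} (f df d2f : R -> R) (x y r C : R) :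
  (forall z, `|z - x| < r -> is_derive z 1 f (df z)) ->
  (forall z, `|z - x| < r -> is_derive z 1 df (d2f z)) ->
  (forall z, `|z - x| < r -> `|d2f z| <= C) ->
  `|y - x| < r -> `|f y - f x - df x * (y - x)| <= C * `|y - x| ^+ 2.
Proof.
move=> h1 h2 hC yr.
have [c cy ->] := MVT_ball _ _ _ _ _ h1 yr.
have cr := le_lt_trans cy yr.
have [e ec] := MVT_ball _ _ _ _ _ h2 cr.
rewrite -mulrBl => ->; rewrite !normrM expr2 mulrA ler_wpM2r//.
by rewrite ler_pM// hC// (le_lt_trans ec).
Qed.

(** Bounds of the form |f(y) - f(x) - l (y - x)| <= C |y - x|^2 pass to pointwise
    limits, unlike derivatives; hence the detour through them. *)
Lemma is_derive_of_quadratic_bound {R : realType} (f : R -> R) (x l r C : R) :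
  0 < r ->
  (forall y, `|y - x| < r -> `|f y - f x - l * (y - x)| <= C * `|y - x| ^+ 2) ->
  is_derive x 1 f l.
Proof.
move=> r0 hf.
have cv : h^-1 *: (f (h *: 1 + x) - f x) @[h --> 0^'] --> l.
  apply/cvgrPdist_le => e e0; near=> h.
  have h0 : h != 0 by near: h; exact: nbhs_dnbhs_neq.
  have hr : `|h| < r by near: h; exact: dnbhs0_lt.
  have he : `|h| < e / (`|C| + 1).
    by near: h; apply: dnbhs0_lt; rewrite divr_gt0// ltr_wpDl.
  rewrite /GRing.scale/= mulr1.
  have := hf (h + x); rewrite addrK => /(_ hr) H.
  rewrite -(ler_pM2r (_ : 0 < `|h|)) ?normr_gt0// distrC -normrM.
  rewrite mulrBl mulrAC mulVf// mul1r.
  apply: le_trans H _; rewrite expr2 mulrA ler_wpM2r//.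
  have C1 : 0 < `|C| + 1 by rewrite ltr_wpDl.
  move: he; rewrite ltr_pdivlMr// => he.
  apply: le_trans (ltW he); rewrite mulrC ler_wpM2l//.
  by rewrite (le_trans (ler_norm _))// lerDl.
split; last exact: cvg_lim cv.
by apply/cvg_ex; exists l.
Unshelve. all: by end_near. Qed.

(** The limits may be pointwise: the uniform bound on second derivatives supplies
    the uniformity that differentiation needs. *)
Lemma is_derive_limit {R : realType} (f df d2f : nat -> R -> R) (F : R -> R)
    (x l r C : R) :
  0 < r ->
  (forall n z, `|z - x| < r -> is_derive z 1 (f n) (df n z)) ->
  (forall n z, `|z - x| < r -> is_derive z 1 (df n) (d2f n z)) ->
  (forall n z, `|z - x| < r -> `|d2f n z| <= C) ->
  (forall y, `|y - x| < r -> f n y @[n --> \oo] --> F y) ->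
  df n x @[n --> \oo] --> l ->
  is_derive x 1 F l.
Proof.
move=> r0 h1 h2 hC fF dfl; apply: (@is_derive_of_quadratic_bound _ _ _ _ r C) => // y yr.
have cv : `|f n y - f n x - df n x * (y - x)| @[n --> \oo] -->
    `|F y - F x - l * (y - x)|.
  apply: cvg_norm; apply: cvgB; first by apply: cvgB; apply: fF; rewrite ?subrr ?normr0.
  exact: cvgMl.
apply: (cvgr_to_le cv); near=> n.
exact: (taylor1_bound (f n) (df n) (d2f n) x y r C (h1 n) (h2 n) (hC n) yr).
Unshelve. all: by end_near. Qed.

(** * Differences of polygamma series *)

Lemma is_derive_invX {R : realType} (c : R) (n : nat) (x : R) : x + c != 0 ->
  is_derive x 1 (fun z => (z + c)^-1 ^+ n.+1) (- (n.+1%:R * (x + c)^-1 ^+ n.+2)).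
Proof.
move=> xc.
have H1 : is_derive x 1 (fun z : R => z + c) 1.
  by have H := @is_deriveD _ _ _ id (cst c) x 1 1 0 _ _; apply: is_derive_eq; rewrite addr0.
have H2 := @is_deriveV _ (fun z => z + c) x 1 1 xc H1.
have H3 := @is_deriveX _ _ _ n.+1 _ _ _ H2.
have -> : (fun z => (z + c)^-1 ^+ n.+1) = (fun z => (z + c)^-1) ^+ n.+1.
  by rewrite exprfctE.
apply: is_derive_eq; rewrite /GRing.scale/= mulr1.
by rewrite [in RHS]exprS [in RHS]exprS -exprVn expr2; ring.
Qed.

(** Telescoping: up to boundary terms the sum is that of the first M values. *)
Lemma sum_shift_le {R : realFieldType} (s : nat -> R) (M N : nat) :
  (forall k, 0 <= s k) -> (forall k, s k.+1 <= s k) ->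
  \sum_(k < N) (s k - s (k + M)%N) <= M%:R * s 0%N.
Proof.
move=> s0 sd; elim: M => [|M IH].
  by rewrite mul0r big1// => k _; rewrite addn0 subrr.
have sM : s M <= s 0%N by elim: M {IH} => // M; exact: le_trans.
rewrite -natr1 mulrDl mul1r.
rewrite (eq_bigr (fun k : 'I_N => s k - s (k + M)%N + (s (k + M)%N - s (k + M).+1))); last first.
  by move=> k _; rewrite addnS; ring.
rewrite big_split/= lerD// (le_trans _ sM)//.
have -> : \sum_(k < N) (s (k + M)%N - s (k + M).+1) = s M - s (N + M)%N.
  elim: N {IH} => [|N IHN]; first by rewrite big_ord0 subrr.
  by rewrite big_ord_recr/= IHN; ring.
by rewrite lerBlDr lerDl.
Qed.

Definition polygamma_partial {R : realType} (a b : R) (n : nat) (x : R) (N : nat) : R :=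
  \sum_(k < N) ((x + (b + k%:R))^-1 ^+ n.+1 - (x + (a + k%:R))^-1 ^+ n.+1).

Definition polygamma_diff {R : realType} (a b : R) (n : nat) (x : R) : R :=
  limn (polygamma_partial a b n x).


Lemma invX_le {R : realFieldType} (n : nat) (x y : R) :
  0 < x -> x <= y -> y^-1 ^+ n <= x^-1 ^+ n.
Proof.
move=> x0 xy; have y0 := lt_le_trans x0 xy.
by apply: lerXn2r; rewrite ?nnegrE ?invr_ge0 ?(ltW x0) ?(ltW y0)// lef_pV2.
Qed.

Lemma invX_lt {R : realFieldType} (n : nat) (x y : R) :
  0 < x -> x < y -> y^-1 ^+ n.+1 < x^-1 ^+ n.+1.
Proof.
move=> x0 xy; have y0 := lt_trans x0 xy.
by rewrite ltrXn2r ?nnegrE ?invr_ge0 ?(ltW x0) ?(ltW y0)// ltf_pV2.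
Qed.

Lemma polygamma_term_gt0 {R : realFieldType} (a b x : R) (n k : nat) :
  0 < b -> b < a -> 0 < x ->
  0 < (x + (b + k%:R))^-1 ^+ n.+1 - (x + (a + k%:R))^-1 ^+ n.+1.
Proof.
move=> b0 ba x0; rewrite subr_gt0; apply: invX_lt.
  by rewrite addr_gt0// ltr_wpDr.
by rewrite ltrD2l ltrD2r.
Qed.

Lemma polygamma_partial_nd {R : realType} (a b x : R) (n : nat) :
  0 < b -> b < a -> 0 < x -> nondecreasing_seq (polygamma_partial a b n x).
Proof.
move=> b0 ba x0; apply/nondecreasing_seqP => N.
rewrite /polygamma_partial big_ord_recr/= lerDl ltW//.
exact: polygamma_term_gt0.
Qed.

(** Replacing [a - b] by a larger integer only increases the terms and makes the
    sum telescope. *)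
Lemma polygamma_partial_le {R : realType} (a b x : R) (n N : nat) :
  0 < b -> b < a -> 0 < x ->
  polygamma_partial a b n x N <= (Num.bound (a - b))%:R * (x + b)^-1 ^+ n.+1.
Proof.
move=> b0 ba x0; set M := Num.bound _.
have aM : a - b < M%:R by apply: archi_boundP; rewrite subr_ge0 ltW.
pose s k : R := (x + (b + k%:R))^-1 ^+ n.+1.
have xb0 (k : nat) : 0 < x + (b + k%:R) by rewrite addr_gt0// ltr_wpDr.
have s0 : s 0%N = (x + b)^-1 ^+ n.+1 by rewrite /s mulr0n addr0.
have := @sum_shift_le R s M N; rewrite s0 => H; apply: le_trans (H _ _).
- apply: ler_sum => k _; rewrite lerD2l lerN2; apply: invX_le.
    by rewrite addr_gt0// ltr_wpDr// (lt_trans b0).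
  by rewrite lerD2l natrD; move: aM; lra.
- by move=> k; rewrite exprn_ge0// invr_ge0 ltW.
- by move=> k; apply: invX_le; rewrite // lerD2l lerD2l ler_nat.
Qed.

Lemma polygamma_cvg {R : realType} (a b x : R) (n : nat) :
  0 < b -> b < a -> 0 < x ->
  polygamma_partial a b n x N @[N --> \oo] --> polygamma_diff a b n x.
Proof.
move=> b0 ba x0; apply: nondecreasing_is_cvgn.
  exact: polygamma_partial_nd.
eexists => _ [N _ <-]; exact: polygamma_partial_le.
Qed.

Lemma polygamma_diff_gt0 {R : realType} (a b x : R) (n : nat) :
  0 < b -> b < a -> 0 < x -> 0 < polygamma_diff a b n x.
Proof.
move=> b0 ba x0.
apply: (@lt_le_trans _ _ (polygamma_partial a b n x 1)).
  by rewrite /polygamma_partial big_ord1 polygamma_term_gt0.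
apply: nondecreasing_cvgn_le; first exact: polygamma_partial_nd.
by apply/cvg_ex; exists (polygamma_diff a b n x); exact: polygamma_cvg.
Qed.

Lemma polygamma_diff_le {R : realType} (a b x : R) (n : nat) :
  0 < b -> b < a -> 0 < x ->
  polygamma_diff a b n x <= (Num.bound (a - b))%:R * (x + b)^-1 ^+ n.+1.
Proof.
move=> b0 ba x0; apply: (cvgr_to_le (polygamma_cvg _ _ _ n b0 ba x0)).
by near=> N; exact: polygamma_partial_le.
Unshelve. all: by end_near. Qed.

Lemma is_derive_polygamma_partial {R : realType} (a b x : R) (n N : nat) :
  0 < b -> b < a -> 0 < x ->
  is_derive x 1 (polygamma_partial a b n ^~ N)
    (- (n.+1%:R * polygamma_partial a b n.+1 x N)).
Proof.
move=> b0 ba x0.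
have h (k : 'I_N) : is_derive x 1
   ((fun z => (z + (b + k%:R))^-1 ^+ n.+1) - (fun z => (z + (a + k%:R))^-1 ^+ n.+1))
   (- (n.+1%:R * (x + (b + k%:R))^-1 ^+ n.+2) -
     - (n.+1%:R * (x + (a + k%:R))^-1 ^+ n.+2)).
  apply: is_deriveB; apply: is_derive_invX; rewrite gt_eqF// addr_gt0// ltr_wpDr//.
  exact: lt_trans ba.
have H := is_derive_sum h.
have E : \sum_(k < N) ((fun z => (z + (b + k%:R))^-1 ^+ n.+1) -
    (fun z => (z + (a + k%:R))^-1 ^+ n.+1)) = (polygamma_partial a b n ^~ N).
  by apply/funext => z; rewrite fct_sumE.
rewrite -E; apply: is_derive_eq.
by rewrite mulr_sumr -sumrN; apply: eq_bigr => k _; ring.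
Qed.

(** Term-by-term differentiation: on the ball of radius [x] about [x] all points
    are positive, and there [polygamma_partial_le] bounds the second derivatives
    uniformly, the shift by [b > 0] keeping denominators away from 0. *)
Lemma signed_jet_polygamma_diff {R : realType} (a b : R) :
  0 < b -> b < a -> signed_jet (polygamma_diff a b).
Proof.
move=> b0 ba n x x0; set M : R := (Num.bound (a - b))%:R.
have pos z : `|z - x| < x -> 0 < z.
  by rewrite ltr_norml => /andP[]; lra.
apply: (@is_derive_limit _ (fun N z => polygamma_partial a b n z N)
  (fun N z => - (n.+1%:R * polygamma_partial a b n.+1 z N))
  (fun N z => n.+1%:R * (n.+2%:R * polygamma_partial a b n.+2 z N))
  _ _ _ x (n.+1%:R * (n.+2%:R * (M * b^-1 ^+ n.+3)))) => //.
- by move=> N z /pos z0; exact: is_derive_polygamma_partial.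
- move=> N z /pos z0.
  have H := @is_derive_polygamma_partial _ a b z n.+1 N b0 ba z0.
  have H2 := @is_deriveN _ _ _ _ _ _ _ (@is_deriveZ _ _ _ _ n.+1%:R _ _ _ H).
  by apply: is_derive_eq; rewrite /GRing.scale/=; ring.
- move=> N z /pos z0; rewrite !normrM !ger0_norm ?ler0n//; last first.
    have := @polygamma_partial_nd _ _ _ _ n.+2 b0 ba z0 0%N N isT.
    by rewrite {1}/polygamma_partial big_ord0.
  do 2! (apply: ler_wpM2l; first exact: ler0n).
  apply: le_trans (@polygamma_partial_le _ _ _ _ n.+2 N b0 ba z0) _.
  by apply: ler_wpM2l; [exact: ler0n|apply: invX_le => //; rewrite lerDr ltW].
- by move=> y /pos y0; exact: polygamma_cvg.
- by apply: cvgN; apply: cvgMr; exact: polygamma_cvg.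
Qed.

(** * Integrals of nonnegative functions over the positive half-line *)

(** The type is pinned to the Borel structure, as measurability is needed there. *)
Definition halfline {R : realType} : set (measurableTypeR R) := `]0%R, +oo[%classic.

Definition posint {R : realType} (f : R -> R) : \bar R :=
  (\int[@lebesgue_measure R]_(t in halfline) (f t)%:E)%E.

Definition nnmeas {R : realType} (f : R -> R) : Prop :=
  measurable_fun (@halfline R) f /\ forall t : R, 0 < t -> 0 <= f t.

Lemma halflineP {R : realType} (t : R) : halfline t <-> 0 < t.
Proof. by rewrite /halfline/= in_itv/= andbT. Qed.

Lemma measurable_halfline {R : realType} : measurable (@halfline R).
Proof. exact: measurable_itv. Qed.

Lemma nnmeas_continuous {R : realType} (f : R -> R) :
  (forall t : R, 0 < t -> {for t, continuous f}) -> (forall t : R, 0 < t -> 0 <= f t) ->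
  nnmeas f.
Proof.
move=> cf f0; split=> //; apply: open_continuous_measurable_fun.
  exact: interval_open.
by move=> t; rewrite inE => /halflineP; exact: cf.
Qed.

Lemma nnmeasM {R : realType} (f g : R -> R) :
  nnmeas f -> nnmeas g -> nnmeas (fun t => f t * g t).
Proof.
move=> [mf f0] [mg g0]; split; first exact: measurable_funM.
by move=> t t0; rewrite mulr_ge0 ?f0 ?g0.
Qed.

Lemma nnmeasD {R : realType} (f g : R -> R) :
  nnmeas f -> nnmeas g -> nnmeas (fun t => f t + g t).
Proof.
move=> [mf f0] [mg g0]; split; first exact: measurable_funD.
by move=> t t0; rewrite addr_ge0 ?f0 ?g0.
Qed.

Lemma nnmeas_cst {R : realType} (k : R) : 0 <= k -> nnmeas (fun=> k).
Proof. by move=> k0; split=> //; exact: measurable_cst. Qed.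

Lemma nnmeas_expR {R : realType} (c : R) : nnmeas (fun t => expR (- (c * t))).
Proof.
split=> [|t _]; last exact: expR_ge0.
by apply: measurableT_comp => //; apply: measurableT_comp => //.
Qed.

Lemma nnmeasX {R : realType} (n : nat) : @nnmeas R (fun t => t ^+ n).
Proof.
by split=> [|t t0]; [exact: measurable_funX|rewrite exprn_ge0// ltW].
Qed.

Lemma nnmeas_powR {R : realType} (x : R) : @nnmeas R (fun t => t `^ x).
Proof.
split=> [|t _]; last exact: powR_ge0.
by apply: measurable_funTS; exact: measurable_powR.
Qed.

Lemma nnmeas_EFin {R : realType} (f : R -> R) : nnmeas f ->
  measurable_fun (@halfline R) (EFin \o f) /\
  forall t, halfline t -> (0 <= (f t)%:E)%E.
Proof.
move=> [mf f0]; split; first exact/measurable_EFinP.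
by move=> t /halflineP t0; rewrite lee_fin f0.
Qed.

Lemma posint_ge0 {R : realType} (f : R -> R) : nnmeas f -> (0 <= posint f)%E.
Proof. by move=> /nnmeas_EFin[_ f0]; exact: integral_ge0. Qed.

Lemma eq_posint {R : realType} (f g : R -> R) :
  (forall t : R, 0 < t -> f t = g t) -> posint f = posint g.
Proof.
by move=> fg; apply: eq_integral => t; rewrite inE => /halflineP t0; rewrite fg.
Qed.

Lemma posint_le {R : realType} (f g : R -> R) : nnmeas f -> nnmeas g ->
  (forall t : R, 0 < t -> f t <= g t) -> (posint f <= posint g)%E.
Proof.
move=> /nnmeas_EFin[mf f0] /nnmeas_EFin[mg g0] fg.
apply: ge0_le_integral => //; first exact: measurable_halfline.
by move=> t /halflineP t0; rewrite lee_fin fg.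
Qed.

Lemma posintD {R : realType} (f g : R -> R) : nnmeas f -> nnmeas g ->
  posint (fun t => f t + g t) = (posint f + posint g)%E.
Proof.
move=> /nnmeas_EFin[mf f0] /nnmeas_EFin[mg g0].
by rewrite /posint -ge0_integralD//; exact: measurable_halfline.
Qed.

Lemma posintZ {R : realType} (k : R) (f : R -> R) : 0 <= k -> nnmeas f ->
  posint (fun t => k * f t) = (k%:E * posint f)%E.
Proof.
move=> k0 /nnmeas_EFin[mf f0].
rewrite /posint -ge0_integralZl_EFin//; exact: measurable_halfline.
Qed.

Lemma posint_monotone_cvg {R : realType} (f : nat -> R -> R) (g : R -> R) :
  (forall n, nnmeas (f n)) ->
  (forall t : R, 0 < t -> nondecreasing_seq (f ^~ t)) ->
  (forall t : R, 0 < t -> f n t @[n --> \oo] --> g t) ->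
  (posint (f n) @[n --> \oo] --> posint g)%E.
Proof.
move=> nf ndf fg.
have -> : posint g =
    (\int[@lebesgue_measure R]_(t in halfline) limn (fun n => (f n t)%:E))%E.
  apply: eq_integral => t; rewrite inE => /halflineP t0.
  by apply/esym/cvg_lim => //; apply: cvg_EFin; [exact: nearW|exact: fg].
apply: cvg_monotone_convergence.
- exact: measurable_halfline.
- by move=> n; have [] := nnmeas_EFin _ (nf n).
- by move=> n t tp; have [_ /(_ t tp)] := nnmeas_EFin _ (nf n).
- by move=> t /halflineP t0 m n mn; rewrite lee_fin; exact: ndf.
Qed.

(** * The Gamma integral *)

(** Euler's integral with a scale [c]: [c = 1] is Gamma, while integral [x] gives
    the moments of an exponential, so one recurrence serves both. Extended-real
    values allow the recurrence to be proved before finiteness. *)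
Definition egamma {R : realType} (c x : R) : \bar R :=
  posint (fun t => t `^ (x - 1) * expR (- (c * t))).

Lemma nnmeas_egamma {R : realType} (c x : R) :
  nnmeas (fun t => t `^ x * expR (- (c * t))).
Proof. exact: nnmeasM (nnmeas_powR _) (nnmeas_expR _). Qed.

Lemma is_derive_expR_scale {R : realType} (c t : R) :
  is_derive t 1 (fun s => expR (- (c * s))) (- (c * expR (- (c * t)))).
Proof.
have H1 : is_derive t 1 (fun s => - (c * s)) (- c).
  have H := @is_deriveN _ _ _ _ _ _ _ (@is_deriveZ _ _ _ id c t 1 1 _).
  by apply: is_derive_eq; rewrite /GRing.scale/= mulr1.
have H2 := @is_derive1_comp _ expR (fun s => - (c * s)) t _ _ (is_derive_expR _) H1.
by apply: is_derive_eq; rewrite /GRing.scale/=; ring.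
Qed.

Lemma is_derive_expRN {R : realType} (c t : R) :
  is_derive t 1 (fun s => - expR (- (c * s))) (c * expR (- (c * t))).
Proof.
have H3 := @is_deriveN _ _ _ _ _ _ _ (is_derive_expR_scale c t).
by apply: is_derive_eq; rewrite opprK.
Qed.

Lemma is_derive_continuous {R : realType} (f : R -> R) (t df : R) :
  is_derive t 1 f df -> {for t, continuous f}.
Proof. by move=> [d _]; apply: differentiable_continuous; exact/derivable1_diffP. Qed.

Lemma derivable_LRcontinuous {R : realType} (f df : R -> R) (u v : R) : 0 < u ->
  u < v ->
  (forall t : R, 0 < t -> is_derive t 1 f (df t)) -> derivable_oo_LRcontinuous f u v.
Proof.
move=> u0 uv h; have v0 := lt_trans u0 uv; split.
- by move=> t; rewrite in_itv/= => /andP[ut _]; have [] := h t (lt_trans u0 ut).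
- by apply: cvg_at_right_filter; exact: is_derive_continuous (h u u0).
- by apply: cvg_at_left_filter; exact: is_derive_continuous (h v v0).
Qed.

Lemma continuous_within_pos {R : realType} (f df : R -> R) (u v : R) : 0 < u ->
  (forall t : R, 0 < t -> is_derive t 1 f (df t)) -> {within `[u, v], continuous f}.
Proof.
move=> u0 h; apply: derivable_within_continuous => t.
by rewrite in_itv/= => /andP[ut _]; have [] := h t (lt_le_trans u0 ut).
Qed.

Lemma gamma_by_parts_itv {R : realType} (c x u v : R) :
  0 <= x -> 0 < u -> u < v ->
  (\int[@lebesgue_measure R]_(t in `[u, v]) (c * (t `^ x * expR (- (c * t))))%:E =
   (u `^ x * expR (- (c * u)) - v `^ x * expR (- (c * v)))%:E +
   \int[@lebesgue_measure R]_(t in `[u, v]) (x * (t `^ (x - 1) * expR (- (c * t))))%:E)%E.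
Proof.
move=> x0 u0 uv.
pose F (t : R) := t `^ x; pose f (t : R) := x * t `^ (x - 1).
pose G (t : R) := - expR (- (c * t)); pose g (t : R) := c * expR (- (c * t)).
have dF (t : R) : 0 < t -> is_derive t 1 F (f t) by exact: is_derive1_powR.
have dG (t : R) : is_derive t 1 G (g t) by exact: is_derive_expRN.
have df (t : R) : 0 < t -> is_derive t 1 f (x * ((x - 1) * t `^ (x - 1 - 1))).
  move=> t0; have H := @is_deriveZ _ _ _ _ x _ _ _ (is_derive1_powR (x - 1) t0).
  by apply: is_derive_eq.
have dg (t : R) : is_derive t 1 g (c * (- (c * expR (- (c * t))))).
  have H := @is_deriveZ _ _ _ _ c _ _ _ (is_derive_expR_scale c t).
  by apply: is_derive_eq.
have inpos (t : R) : t \in `]u, v[ -> 0 < t.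
  by rewrite in_itv/= => /andP[ut _]; exact: lt_trans ut.
have F'f : {in `]u, v[, derive1 F =1 f}.
  by move=> t /inpos t0; rewrite derive1E; have [_ ->] := dF t t0.
have G'g : {in `]u, v[, derive1 G =1 g}.
  by move=> t _; rewrite derive1E; have [_ ->] := dG t.
have H := @integration_by_parts R F G f g u v uv
  (continuous_within_pos _ _ u v u0 df) (derivable_LRcontinuous _ _ u v u0 uv dF) F'f
  (continuous_within_pos _ _ u v u0 (fun t _ => dg t))
  (derivable_LRcontinuous _ _ u v u0 uv (fun t _ => dG t)) G'g.
transitivity (\int[@lebesgue_measure R]_(t in `[u, v]) (F t * g t)%:E)%E.
  by apply: eq_integral => t _; rewrite /F /g; congr EFin; ring.
rewrite H; congr (_ + _)%E; first by congr EFin; rewrite /F /G; ring.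
(* The sign is moved outside, so that the integrand is nonnegative. *)
transitivity (- \int[@lebesgue_measure R]_(t in `[u, v])
  - (x * (t `^ (x - 1) * expR (- (c * t))))%:E)%E.
  by congr (- _)%E; apply: eq_integral => t _; rewrite -EFinN /f /G; congr EFin; ring.
rewrite integral_ge0N ?oppeK// => t _.
by rewrite lee_fin mulr_ge0// mulr_ge0 ?powR_ge0 ?expR_ge0.
Qed.

(** Exponential decay beats powers; the constant comes from one term of the
    exponential series. *)
Lemma powR_expR_bound {R : realType} (c x : R) : 0 < c ->
  exists C : R, forall t, 1 <= t -> t `^ x * expR (- (c * t)) <= C / t.
Proof.
move=> c0; pose k := Num.bound `|x|.
have xk : x <= k%:R by apply: le_trans (ler_norm x) (ltW (archi_boundP _)).
exists (k.+1`!%:R / c ^+ k.+1) => t t1; have t0 : 0 < t by exact: lt_le_trans t1.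
have h : (c * t) ^+ k.+1 / k.+1`!%:R <= expR (c * t).
  by have := @expR_ge1Dxn R (c * t) k (ltW (mulr_gt0 c0 t0)); lra.
rewrite expRN ler_pdivlMr// mulrAC ler_pdivrMr ?expR_gt0//.
apply: (@le_trans _ _ (t ^+ k.+1)).
  rewrite exprSr ler_wpM2r ?(ltW t0)// -powR_mulrn ?(ltW t0)//.
  exact: ler_powR.
have fk : 0 < (k.+1`!%:R : R) by rewrite ltr0n fact_gt0.
rewrite -(ler_pM2l (_ : 0 < k.+1`!%:R / c ^+ k.+1 :> R)) in h; last first.
  by rewrite divr_gt0// exprn_gt0.
apply: le_trans h; rewrite exprMn le_eqVlt; apply/orP; left; apply/eqP.
by field; rewrite ?gt_eqF// ?exprn_gt0.
Qed.

Lemma invSS_cvg {R : realType} : (n.+2%:R^-1 : R) @[n --> \oo] --> 0.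
Proof. by have := @cvg_harmonic R; rewrite -cvg_shiftS. Qed.

(** The boundary term [q] at 0 is kept: it is 0 for x > 0, but 1 for x = 0, which
    starts the computation at [egamma c 1]. The segments [1/(n+2), n+2] exhaust
    the half-line and stay away from the singularity at 0. *)
Lemma egamma_rec {R : realType} (c x q : R) : 0 < c -> 0 <= x ->
  n.+2%:R^-1 `^ x * expR (- (c * n.+2%:R^-1)) @[n --> \oo] --> q ->
  (c%:E * egamma c (x + 1) = q%:E + x%:E * egamma c x)%E.
Proof.
move=> c0 x0 hq.
pose I (n : nat) : set (measurableTypeR R) := `[n.+2%:R^-1, n.+2%:R]%classic.
have Ipos n t : I n t -> 0 < t.
  by rewrite /I/= in_itv/= => /andP[+ _]; apply: lt_le_trans; rewrite invr_gt0.
have nI : nondecreasing_seq I.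
  apply/nondecreasing_seqP => n; apply/subsetPset => t.
  rewrite /I/= !in_itv/= => /andP[h1 h2]; apply/andP; split.
    by apply: le_trans h1; rewrite lef_pV2 ?posrE// ler_nat.
  by apply: le_trans h2 _; rewrite ler_nat.
have UI : \bigcup_n I n = halfline.
  apply/seteqP; split=> t; first by move=> [n _ /Ipos t0]; apply/halflineP.
  move=> /halflineP t0; pose n := Num.bound (t + t^-1).
  have it0 : 0 < t^-1 by rewrite invr_gt0.
  have : t + t^-1 < n%:R by apply: archi_boundP; exact: addr_ge0 (ltW t0) (ltW it0).
  have nn : (n%:R : R) <= n.+2%:R by rewrite ler_nat ltnW.
  move=> tn; exists n => //; rewrite /I/= in_itv/=; apply/andP; split; last by lra.
  by rewrite -[leRHS]invrK lef_pV2 ?posrE//; lra.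
have cvI (f : R -> R) : nnmeas f ->
    (\int[@lebesgue_measure R]_(t in I n) (f t)%:E @[n --> \oo] --> posint f)%E.
  move=> nf; rewrite /posint -UI; apply: ge0_nondecreasing_set_cvg_integral => //.
  - by move=> n; exact: measurable_itv.
  - move=> n; have [mf _] := nnmeas_EFin _ nf; apply: measurable_funS mf.
      exact: measurable_halfline.
    by move=> t /Ipos t0; apply/halflineP.
  - by move=> n t /Ipos t0; rewrite lee_fin; exact: nf.2.
have e1 : (c%:E * egamma c (x + 1))%E =
    posint (fun t => c * (t `^ x * expR (- (c * t)))).
  by rewrite /egamma addrK posintZ ?(ltW c0)//; exact: nnmeas_egamma.
have e2 : (x%:E * egamma c x)%E =
    posint (fun t => x * (t `^ (x - 1) * expR (- (c * t)))).
  by rewrite /egamma posintZ//; exact: nnmeas_egamma.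
rewrite e1 e2.
have nn1 := nnmeasM _ _ (nnmeas_cst c (ltW c0)) (nnmeas_egamma c x).
have nn2 := nnmeasM _ _ (nnmeas_cst x x0) (nnmeas_egamma c (x - 1)).
have L := cvI _ nn1; have L2 := cvI _ nn2.
have Lq : n.+2%:R `^ x * expR (- (c * n.+2%:R)) @[n --> \oo] --> (0 : R).
  have [C hC] := powR_expR_bound c x c0.
  apply: (@squeeze_cvgr _ _ _ _ (fun=> 0) (fun n => C * n.+2%:R^-1)).
  - near=> n; rewrite mulr_ge0 ?powR_ge0 ?expR_ge0//=; apply: hC.
    by rewrite ler1n.
  - exact: cvg_cst.
  - rewrite -[X in _ --> X](mulr0 C); apply: cvgMr.
    exact: invSS_cvg.
have L3 : ((n.+2%:R^-1 `^ x * expR (- (c * n.+2%:R^-1)) -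
    n.+2%:R `^ x * expR (- (c * n.+2%:R)))%:E @[n --> \oo] --> (q - 0)%:E)%E.
  by apply: cvg_EFin; [exact: nearW|exact: cvgB].
rewrite subr0 in L3.
set P2 := posint (fun t => x * _) in L2 *.
have ad : (q%:E +? P2)%E by [].
have L4 := cvgeD ad L3 L2.
have E n : (\int[@lebesgue_measure R]_(t in I n) (c * (t `^ x * expR (- (c * t))))%:E)%E =
   ((n.+2%:R^-1 `^ x * expR (- (c * n.+2%:R^-1)) -
    n.+2%:R `^ x * expR (- (c * n.+2%:R)))%:E +
    \int[@lebesgue_measure R]_(t in I n) (x * (t `^ (x - 1) * expR (- (c * t))))%:E)%E.
  apply: gamma_by_parts_itv => //; rewrite ?invr_gt0//.
  by rewrite (@lt_trans _ _ 1) ?ltr1n// invf_lt1// ltr1n.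
have L5 : (\int[@lebesgue_measure R]_(t in I n) (c * (t `^ x * expR (- (c * t))))%:E
    @[n --> \oo] --> q%:E + P2)%E.
  apply: cvg_trans (L4 _); apply: near_eq_cvg; apply: nearW => n.
  by rewrite /= E.
rewrite -(cvg_lim (@ereal_hausdorff R) L).
by rewrite (cvg_lim (@ereal_hausdorff R) L5).
Unshelve. all: by end_near. Qed.

Lemma egammaS {R : realType} (c x : R) : 0 < c -> 0 < x ->
  (c%:E * egamma c (x + 1) = x%:E * egamma c x)%E.
Proof.
move=> c0 x0; rewrite (egamma_rec c x 0)// ?add0e ?ltW//.
apply: (@squeeze_cvgr _ _ _ _ (fun=> 0) (fun n => n.+2%:R^-1 `^ x)).
- near=> n; rewrite mulr_ge0 ?powR_ge0 ?expR_ge0//= ler_piMr ?powR_ge0//.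
  by rewrite expR_le1 oppr_le0 mulr_ge0 ?invr_ge0// ltW.
- exact: cvg_cst.
- have /cvg_at_rightP := @powR_cvg0 R x x0; apply; split=> //.
  exact: invSS_cvg.
Unshelve. all: by end_near. Qed.

Lemma egamma1 {R : realType} (c : R) : 0 < c -> egamma c 1 = (c^-1)%:E.
Proof.
move=> c0; have := @egamma_rec _ c 0 1 c0 (lexx 0).
rewrite add0r mul0e adde0 => H.
have : (c%:E * egamma c 1 = 1%:E)%E.
  apply: H; under eq_fun do rewrite powRr0 mul1r.
  have h : - (c * n.+2%:R^-1) @[n --> \oo] --> (- (c * 0) : R).
    by apply: cvgN; apply: cvgMr; exact: invSS_cvg.
  rewrite mulr0 oppr0 in h.
  by have := cvg_comp _ _ h (@continuous_expR R 0); rewrite expR0.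
move=> /(congr1 (fun y => c^-1%:E * y)%E).
by rewrite muleA -EFinM mulVf ?gt_eqF// mul1e mule1.
Qed.

Lemma egamma_nat {R : realType} (c : R) (n : nat) : 0 < c ->
  egamma c n.+1%:R = (n`!%:R / c ^+ n.+1)%:E.
Proof.
move=> c0; elim: n => [|n IH]; first by rewrite egamma1// fact0 mul1r expr1.
have := @egammaS _ c n.+1%:R c0 (ltr0Sn _ _).
rewrite IH natr1 => /(congr1 (fun y => c^-1%:E * y)%E).
rewrite muleA -EFinM mulVf ?gt_eqF// mul1e => ->.
rewrite -!EFinM; congr EFin; rewrite factS natrM !exprS.
by field; rewrite expf_neq0// gt_eqF.
Qed.

Lemma posint_exp_moment {R : realType} (c : R) (n : nat) : 0 < c ->
  posint (fun t => t ^+ n * expR (- (c * t))) = (n`!%:R / c ^+ n.+1)%:E.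
Proof.
move=> c0; rewrite -egamma_nat//; apply: eq_posint => t t0.
by rewrite -natr1 addrK powR_mulrn// ltW.
Qed.

(** * The Gamma function *)

(** Weighted AM-GM, from 1 + s <= e^s applied at two points. *)
Lemma powR_young {R : realType} (t h : R) : 0 < t -> 0 <= h <= 1 ->
  t `^ h <= (1 - h) + h * t.
Proof.
move=> t0 /andP[h0 h1]; rewrite /powR gt_eqF//.
set s := ln t; have -> : t = expR s by rewrite lnK// posrE.
have e1 := expR_ge1Dx (- (h * s)); have e2 := expR_ge1Dx ((1 - h) * s).
rewrite -(ler_pM2l (expR_gt0 (- (h * s)))) -expRD addNr expR0 mulrDr.
have -> : expR (- (h * s)) * (h * expR s) = h * expR ((1 - h) * s).
  by rewrite mulrCA -expRD; congr (_ * expR _); ring.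
have i1 : (1 - h) * (1 + - (h * s)) <= (1 - h) * expR (- (h * s)).
  by rewrite ler_wpM2l// subr_ge0.
have i2 : h * (1 + (1 - h) * s) <= h * expR ((1 - h) * s) by rewrite ler_wpM2l.
by rewrite [expR _ * (1 - h)]mulrC; lra.
Qed.

(** [powR_young] at t / s, integrated. The free parameter [s] is used with s = 1
    for finiteness and positivity, and with the optimal s = x for the slopes. *)
Lemma egamma_young {R : realType} (x h s : R) : 0 < s -> 0 <= h <= 1 ->
  (egamma 1 (x + h) <= (s `^ h * (1 - h))%:E * egamma 1 x +
                       (s `^ h * (h / s))%:E * egamma 1 (x + 1))%E.
Proof.
move=> s0 h01; have /andP[h0 h1] := h01.
have A0 : 0 <= s `^ h * (1 - h) by rewrite mulr_ge0 ?powR_ge0// subr_ge0.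
have B0 : 0 <= s `^ h * (h / s) by rewrite mulr_ge0 ?powR_ge0// divr_ge0// ltW.
rewrite /egamma -!posintZ//; [|exact: nnmeas_egamma..].
rewrite -posintD; [|exact: nnmeasM (nnmeas_cst _ _) (nnmeas_egamma _ _)..].
apply: posint_le; first exact: nnmeas_egamma.
  apply: nnmeasD; exact: nnmeasM (nnmeas_cst _ _) (nnmeas_egamma _ _).
move=> t t0.
have -> : t `^ (x + h - 1) = t `^ (x - 1) * (s `^ h * (t / s) `^ h).
  rewrite -powRM ?(ltW s0) ?divr_ge0 ?(ltW t0) ?(ltW s0)// mulrCA mulfV ?gt_eqF// mulr1.
  by rewrite -powRD; [congr (_ `^ _); ring|rewrite (gt_eqF t0) implybT].
have -> : t `^ (x + 1 - 1) = t `^ (x - 1) * t.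
  rewrite -[X in _ = _ * X](powRr1 (ltW t0)).
  by rewrite -powRD; [congr (_ `^ _); ring|rewrite (gt_eqF t0) implybT].
have := powR_young (t / s) h (divr_gt0 t0 s0) h01.
move=> /(ler_wpM2l (mulr_ge0 (mulr_ge0 (powR_ge0 t (x - 1)) (powR_ge0 s h))
   (expR_ge0 (- (1 * t))))) H.
have -> : t `^ (x - 1) * (s `^ h * (t / s) `^ h) * expR (- (1 * t)) =
  t `^ (x - 1) * s `^ h * expR (- (1 * t)) * (t / s) `^ h by ring.
apply: le_trans H _; rewrite le_eqVlt; apply/orP; left; apply/eqP; field.
by rewrite gt_eqF.
Qed.

(** For x >= 1 interpolate between integers, where the value is a factorial; the
    recurrence then transports finiteness down to (0, 1). *)
Lemma egamma_fin_num {R : realType} (x : R) : 0 < x -> egamma 1 x \is a fin_num.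
Proof.
have g0 (y : R) : (0 <= egamma 1 y)%E by apply: posint_ge0; exact: nnmeas_egamma.
have ge1 (y : R) : 1 <= y -> (egamma 1 y < +oo)%E.
  move=> y1; have y0 : 0 <= y by apply: le_trans y1.
  have /andP[] := truncn_itv y0; case E : (Num.truncn y) => [|n] ny yn.
    by move: (lt_le_trans yn y1); rewrite ltxx.
  have h01 : 0 <= y - n.+1%:R <= 1.
    by rewrite subr_ge0 ny/= lerBlDl natr1 ltW.
  have := egamma_young n.+1%:R (y - n.+1%:R) 1 ltr01 h01.
  rewrite addrC subrK natr1 !egamma_nat// -!EFinM -EFinD => H.
  exact: le_lt_trans H (ltry _).
move=> x0; rewrite ge0_fin_numE//.
have := @egammaS R 1 x ltr01 x0; rewrite mul1e => H.
have : (egamma 1 (x + 1) < +oo)%E by apply: ge1; rewrite lerDr ltW.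
rewrite H; have := g0 x; case: (egamma 1 x) => [r _ _| _|//].
  by rewrite ltry.
by rewrite gt0_muley ?lte_fin.
Qed.

Lemma GammaE {R : realType} (x : R) : 0 < x -> (Gamma x)%:E = egamma 1 x.
Proof.
move=> x0; rewrite -[RHS]fineK; last exact: egamma_fin_num.
congr EFin; rewrite /Gamma /Rintegral; congr fine; apply: eq_integral => t _.
by rewrite mul1r.
Qed.

Lemma GammaS {R : realType} (x : R) : 0 < x -> Gamma (x + 1) = x * Gamma x.
Proof.
move=> x0; have := @egammaS R 1 x ltr01 x0.
have x10 : 0 < x + 1 by rewrite addr_gt0.
by rewrite mul1e -(GammaE x)// -(GammaE (x + 1))// -EFinM => -[].
Qed.

Lemma Gamma_young {R : realType} (x h s : R) : 0 < x -> 0 < s -> 0 <= h <= 1 ->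
  Gamma (x + h) <= s `^ h * ((1 - h) * Gamma x + h / s * Gamma (x + 1)).
Proof.
move=> x0 s0 h01; have /andP[h0 h1] := h01.
have := egamma_young x h s s0 h01.
have x10 : 0 < x + 1 by rewrite addr_gt0.
have xh0 : 0 < x + h by rewrite ltr_wpDr.
rewrite -(GammaE x)// -(GammaE (x + 1))// -(GammaE (x + h))//.
rewrite -!EFinM -EFinD lee_fin.
by rewrite -!mulrA -mulrDr.
Qed.

(** If Gamma vanished at x it would, by the recurrence and interpolation, vanish at
    the next integer, where it is a factorial. *)
Lemma Gamma_gt0 {R : realType} (x : R) : 0 < x -> 0 < Gamma x.
Proof.
move=> x0; rewrite lt_neqAle -lee_fin GammaE// posint_ge0 ?andbT; last exact: nnmeas_egamma.
apply/eqP => G0; have /andP[] := truncn_itv (ltW x0); set n := Num.truncn x => nx xn.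
have h01 : 0 <= n.+1%:R - x <= 1.
  by move: nx xn; rewrite -(natr1 n) => nx xn; apply/andP; split; lra.
have := Gamma_young x (n.+1%:R - x) 1 x0 ltr01 h01.
rewrite GammaS// -G0 !mulr0 addr0 mulr0 addrC subrK -lee_fin GammaE//.
rewrite egamma_nat// expr1n divr1 lee_fin leNgt ltr0n fact_gt0//.
Qed.

(** * The logarithm of Gamma and the digamma function *)

Definition lnGamma {R : realType} (x : R) : R := ln (Gamma x).

Lemma lnGammaS {R : realType} (x : R) : 0 < x ->
  lnGamma (x + 1) = lnGamma x + ln x.
Proof.
move=> x0; rewrite /lnGamma GammaS// lnM ?posrE ?Gamma_gt0//.
by rewrite addrC.
Qed.

Lemma lnGamma_slope_le {R : realType} (x h : R) : 0 < x -> 0 <= h <= 1 ->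
  lnGamma (x + h) <= lnGamma x + h * ln x.
Proof.
move=> x0 h01; have /andP[h0 h1] := h01.
have := Gamma_young x h x x0 x0 h01.
rewrite GammaS// mulrA divfK ?gt_eqF// -mulrDl subrK mul1r.
rewrite -ler_ln ?posrE ?mulr_gt0 ?powR_gt0 ?Gamma_gt0 ?ltr_wpDr//.
rewrite lnM ?posrE ?powR_gt0 ?Gamma_gt0// ln_powR => H.
by rewrite [leRHS]addrC.
Qed.

Lemma ln_incr_le {R : realType} (x d : R) : 0 < x -> 0 < x + d ->
  ln (x + d) - ln x <= d / x.
Proof.
move=> x0 xd; rewrite -ln_div ?posrE// mulrDl divff ?gt_eqF//.
apply: le_ln1Dx; have := divr_gt0 xd x0.
by rewrite mulrDl divff ?gt_eqF//; lra.
Qed.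

Lemma ln_incr_ge {R : realType} (x d : R) : 0 < x -> 0 < x + d ->
  d / (x + d) <= ln (x + d) - ln x.
Proof.
move=> x0 xd; have := @ln_incr_le _ (x + d) (- d) xd; rewrite addrK => /(_ x0).
by rewrite mulNr; lra.
Qed.

(** The lower bound is the upper bound [lnGamma_slope_le] taken from x + h to
    x + 1, combined with the recurrence. *)
Lemma lnGamma_slope_nonneg {R : realType} (x h : R) : 0 < x -> 0 <= h <= 1 ->
  `|lnGamma (x + h) - lnGamma x - h * ln x| <= x^-1.
Proof.
move=> x0 h01; have /andP[h0 h1] := h01.
have xh0 : 0 < x + h by rewrite ltr_wpDr.
have ub := lnGamma_slope_le x h x0 h01.
have h01' : 0 <= 1 - h <= 1 by rewrite subr_ge0 h1/= gerBl.
have := lnGamma_slope_le (x + h) (1 - h) xh0 h01'.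
have -> : x + h + (1 - h) = x + 1 by ring.
rewrite lnGammaS// => lb.
have i1 : (1 - h) * (ln (x + h) - ln x) <= (1 - h) * (h / x).
  by rewrite ler_wpM2l ?subr_ge0//; exact: ln_incr_le.
have i2 : (1 - h) * (h / x) <= x^-1.
  rewrite mulrA -[leRHS]mul1r ler_wpM2r ?invr_ge0 ?(ltW x0)//.
  by rewrite -[leRHS]mulr1 ler_pM ?subr_ge0// gerBl.
have xi : 0 <= x^-1 by rewrite invr_ge0 ltW.
rewrite ler_norml; move: ub lb i1 i2 xi.
move: (lnGamma (x + h)) (lnGamma x) (ln (x + h)) (ln x) (x^-1) => p q r s t.
by move=> *; apply/andP; split; lra.
Qed.

(** The two-sided estimate that replaces log-convexity of Gamma: its right-hand side
    tends to 0, so the slope of ln Gamma far out is determined. *)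
Lemma lnGamma_slope {R : realType} (x h : R) : 1 < x -> `|h| <= 1 ->
  `|lnGamma (x + h) - lnGamma x - h * ln x| <= 2 / (x - 1).
Proof.
move=> x1; rewrite ler_norml => /andP[hm hM].
have x0 : 0 < x by exact: lt_trans x1.
have xm : 0 < x - 1 by rewrite subr_gt0.
have ix : 0 <= (x - 1)^-1 by rewrite invr_ge0 ltW.
have [h0|h0] := leP 0 h.
  have := lnGamma_slope_nonneg x h x0; rewrite h0 hM => /(_ isT) H.
  apply: le_trans H _.
  have : x^-1 <= (x - 1)^-1 by rewrite lef_pV2 ?posrE// gerBl.
  by move: (x^-1) ((x - 1)^-1) ix => p q; lra.
have xh : 0 < x + h by lra.
have xhi : (x + h)^-1 <= (x - 1)^-1 by rewrite lef_pV2 ?posrE//; lra.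
have nh : (0 <= - h <= 1) = true by apply/andP; split; lra.
have v : 0 <= ln x - ln (x + h) by rewrite subr_ge0 ler_ln ?posrE// gerDl ltW.
have u : ln x - ln (x + h) <= (- h) / (x + h).
  by have := @ln_incr_le _ (x + h) (- h) xh; rewrite addrK; apply.
have w : (- h) * (ln x - ln (x + h)) <= (x - 1)^-1.
  apply: le_trans (_ : _ <= ln x - ln (x + h)) _; first by rewrite ler_piMl//; lra.
  apply: le_trans u _; apply: le_trans xhi.
  by rewrite ger_pMl ?invr_gt0//; lra.
have w0 : 0 <= (- h) * (ln x - ln (x + h)) by rewrite mulr_ge0// oppr_ge0 ltW.
have := lnGamma_slope_nonneg (x + h) (- h) xh; rewrite addrK nh => /(_ isT).
rewrite ler_norml => /andP[l1 l2].
rewrite ler_norml; move: l1 l2 w w0 xhi ix.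
move: (lnGamma (x + h)) (lnGamma x) (ln (x + h)) (ln x) ((x + h)^-1) ((x - 1)^-1).
by move=> p q r s t z *; apply/andP; split; lra.
Qed.

Definition digamma_partial {R : realType} (x : R) (n : nat) : R :=
  ln (x + n%:R) - \sum_(k < n) (x + k%:R)^-1.

Lemma digamma_partial_cvg {R : realType} (x : R) : 0 < x ->
  exists l : R, digamma_partial x n @[n --> \oo] --> l.
Proof.
move=> x0; apply/cvg_ex.
have u0 n : 0 < x + n%:R by rewrite ltr_wpDr.
apply: nonincreasing_is_cvgn.
  apply/nonincreasing_seqP => n; rewrite /digamma_partial big_ord_recr/=.
  have := @ln_incr_le _ (x + n%:R) 1 (u0 n); rewrite -addrA natr1 mul1r => /(_ (u0 _)).
  by move: (\sum_(i < n) _) (ln _) (ln _) ((x + n%:R)^-1) => *; lra.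
suff h n : ln x - x^-1 + (x + n%:R)^-1 <= digamma_partial x n.
  exists (ln x - x^-1) => _ [n _ <-]; apply: le_trans (h n).
  by rewrite lerDl invr_ge0 ltW.
elim: n => [|n]; first by rewrite /digamma_partial big_ord0 addr0 subr0 subrK.
rewrite /digamma_partial big_ord_recr/=.
have := @ln_incr_ge _ (x + n%:R) 1 (u0 n); rewrite -addrA natr1 mul1r => /(_ (u0 _)).
by move: (\sum_(i < n) _) (ln _) (ln _) (ln _) ((x + n%:R)^-1) (x^-1) => *; lra.
Qed.

Lemma is_derive_ln_shift {R : realType} (c x : R) : 0 < x + c ->
  is_derive x 1 (fun y => ln (y + c)) (x + c)^-1.
Proof.
move=> xc.
have H1 : is_derive x 1 (fun z : R => z + c) 1.
  by have H := @is_deriveD _ _ _ id (cst c) x 1 1 0 _ _; apply: is_derive_eq; rewrite addr0.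
have H2 := @is_derive1_comp _ (@ln R) (fun z => z + c) x _ _ (is_derive1_ln xc) H1.
by apply: is_derive_eq; rewrite mulr1.
Qed.

Lemma is_derive_affine {R : realType} (a m x z : R) :
  is_derive z 1 (fun y => a + (y - x) * m) m.
Proof.
have K1 : is_derive z 1 (fun y : R => y - x) 1.
  by have K := @is_deriveB _ _ _ id (cst x) z 1 1 0 _ _; apply: is_derive_eq; rewrite subr0.
have K2 := @is_deriveM _ _ (fun y => y - x) (cst m) z 1 1 0 K1 (is_derive_cst _ _ _).
have K3 := @is_deriveD _ _ _ (cst a) _ z 1 0 _ (is_derive_cst _ _ _) K2.
by apply: is_derive_eq; rewrite /GRing.scale/= mulr0 !add0r mulr1.
Qed.

(** Comparison with the telescoping series of 1/u - 1/(u + 1), for u >= y. *)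
Lemma sum_sqr_inv_le {R : realFieldType} (y : R) (n : nat) : 0 < y ->
  \sum_(k < n) (y + k%:R)^-1 ^+ 2 <= (1 + y^-1) * y^-1.
Proof.
move=> y0; have u0 m : 0 < y + m%:R by rewrite ltr_wpDr.
suff : \sum_(k < n) (y + k%:R)^-1 ^+ 2 <= (1 + y^-1) * (y^-1 - (y + n%:R)^-1).
  move/le_trans; apply; rewrite ler_wpM2l ?addr_ge0 ?invr_ge0 ?(ltW y0)//.
  by rewrite gerBl invr_ge0 ltW.
elim: n => [|n IH]; first by rewrite big_ord0 addr0 subrr mulr0.
rewrite big_ord_recr/=; apply: le_trans (lerD IH (lexx _)) _.
set u := y + n%:R; have -> : y + n.+1%:R = u + 1 by rewrite /u -natr1 addrA.
have up : 0 < u by exact: u0.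
rewrite -subr_ge0.
have -> : (1 + y^-1) * (y^-1 - (u + 1)^-1) - ((1 + y^-1) * (y^-1 - u^-1) + u^-1 ^+ 2) =
    (u / y - 1) / (u ^+ 2 * (u + 1)).
  by field; rewrite !gt_eqF// addr_gt0.
apply: divr_ge0; first by rewrite subr_ge0 ler_pdivlMr// mul1r /u lerDl ler0n.
by apply: mulr_ge0; [rewrite exprn_ge0 // ltW|rewrite addr_ge0 // ltW].
Qed.

Lemma lnGamma_shift {R : realType} (x : R) (n : nat) : 0 < x ->
  lnGamma (x + n%:R) = lnGamma x + \sum_(k < n) ln (x + k%:R).
Proof.
move=> x0; elim: n => [|n IH]; first by rewrite big_ord0 !addr0.
rewrite big_ord_recr/= addrA -IH -natr1 addrA lnGammaS//.
by rewrite ltr_wpDr.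
Qed.

(** The recurrence expresses ln Gamma near x through its values near x + n; by
    [lnGamma_slope] those may be replaced by a linear function of slope
    ln (x + n) up to a vanishing error. The resulting approximations [f n]
    are elementary and their second derivatives are bounded. *)
Lemma digamma_cvg {R : realType} (x : R) : 0 < x ->
  digamma_partial x n @[n --> \oo] --> digamma x.
Proof.
move=> x0; have [l dl] := digamma_partial_cvg x x0.
suff D : is_derive x 1 lnGamma l.
  by rewrite /digamma derive1E -/(@lnGamma R); have [_ ->] := D.
(* Radius x / 2 keeps the points away from 0; radius 1 is the range of
   [lnGamma_slope]. *)
pose r := Num.min (x / 2) 1.
have r0 : 0 < r by rewrite /r lt_min ltr01 divr_gt0.
have rx : r <= x / 2 by rewrite /r ge_min lexx.
have r1 : r <= 1 by rewrite /r ge_min lexx orbT.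
have half z : `|z - x| < r -> x / 2 < z by rewrite ltr_norml => /andP[h _]; lra.
have pos z : `|z - x| < r -> 0 < z by move=> /half; lra.
(* [f n] is ln Gamma recovered from x + n by the recurrence, with ln Gamma
   linearized there. *)
pose f (n : nat) (y : R) :=
  lnGamma x + (y - x) * ln (x + n%:R) - \sum_(k < n) (ln (y + k%:R) - ln (x + k%:R)).
pose df (n : nat) (y : R) := ln (x + n%:R) - \sum_(k < n) (y + k%:R)^-1.
pose d2f (n : nat) (y : R) := \sum_(k < n) (y + k%:R)^-1 ^+ 2.
apply: (@is_derive_limit _ f df d2f _ x l r ((1 + (x / 2)^-1) * (x / 2)^-1)) => //.
- move=> n z /pos z0.
  have h (k : 'I_n) : is_derive z 1 (fun y => ln (y + k%:R) - ln (x + k%:R)) (z + k%:R)^-1.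
    have H := @is_derive_ln_shift _ k%:R z (ltr_wpDr (ler0n _ _) z0).
    have H2 := @is_deriveB _ _ _ _ (cst (ln (x + k%:R))) _ _ _ _ H (is_derive_cst _ _ _).
    by apply: is_derive_eq; rewrite subr0.
  have H := is_derive_sum h.
  have E : \sum_(k < n) (fun y => ln (y + k%:R) - ln (x + k%:R)) =
      (fun y => \sum_(k < n) (ln (y + k%:R) - ln (x + k%:R))).
    by apply/funext => y; rewrite fct_sumE.
  rewrite E in H.
  have H1 : is_derive z 1 (fun y => lnGamma x + (y - x) * ln (x + n%:R)) (ln (x + n%:R)).
    exact: is_derive_affine.
  have H2 := @is_deriveB _ _ _ _ _ _ _ _ _ H1 H.
  by apply: is_derive_eq.
- move=> n z /pos z0.
  have h (k : 'I_n) : is_derive z 1 (fun y => (y + k%:R)^-1) (- (z + k%:R)^-1 ^+ 2).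
    have zk : z + k%:R != 0 by rewrite gt_eqF// ltr_wpDr.
    have := @is_derive_invX _ k%:R 0 z zk; rewrite mul1r.
    by under eq_fun do rewrite expr1.
  have H := is_derive_sum h.
  have E : \sum_(k < n) (fun y : R => (y + k%:R)^-1) = (fun y => \sum_(k < n) (y + k%:R)^-1).
    by apply/funext => y; rewrite fct_sumE.
  rewrite E in H.
  have H2 := @is_deriveB _ _ _ (cst (ln (x + n%:R))) _ _ _ _ _ (is_derive_cst _ _ _) H.
  by apply: is_derive_eq; rewrite sub0r -sumrN; apply: eq_bigr => k _; rewrite opprK.
- move=> n z zr; have z0 := pos z zr.
  rewrite ger0_norm; last by apply: sumr_ge0 => k _; rewrite exprn_ge0// invr_ge0 addr_ge0// ltW.
  apply: le_trans (sum_sqr_inv_le z n z0) _.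
  have i : z^-1 <= (x / 2)^-1 by rewrite lef_pV2 ?posrE ?divr_gt0// ltW// half.
  have zi : 0 <= z^-1 by rewrite invr_ge0 ltW.
  by rewrite ler_pM ?addr_ge0// lerD2l.
- move=> y yr; have y0 := pos y yr.
  have E n : f n y = lnGamma y -
      (lnGamma (x + n%:R + (y - x)) - lnGamma (x + n%:R) - (y - x) * ln (x + n%:R)).
    have -> : x + n%:R + (y - x) = y + n%:R by ring.
    rewrite !lnGamma_shift// /f sumrB.
    by move: (\sum_(i < n) _) (\sum_(i < n) _) (lnGamma _) (lnGamma _) => *; ring.
  apply/cvgrPdist_le => e e0; near=> n.
  rewrite E opprB addrC subrK.
  have hn : 2 / e + 1 < n%:R by near: n; exact: nbhs_infty_gtr.
  have e2 : 0 < 2 / e by rewrite divr_gt0.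
  have yx : `|y - x| <= 1 by exact: le_trans (ltW yr) r1.
  apply: le_trans (lnGamma_slope (x + n%:R) (y - x) _ yx) _; first by lra.
  have n0 : 0 < x + n%:R - 1 by lra.
  by rewrite ler_pdivrMr// mulrC -ler_pdivrMr//; lra.
Unshelve. all: by end_near. Qed.

Lemma digamma_diff {R : realType} (a b x : R) : 0 < b -> b < a -> 0 < x ->
  digamma (x + a) - digamma (x + b) = polygamma_diff a b 0 x.
Proof.
move=> b0 ba x0.
have a0 : 0 < a by exact: lt_trans ba.
have xa : 0 < x + a by rewrite addr_gt0.
have xb : 0 < x + b by rewrite addr_gt0.
have L2 := polygamma_cvg a b x 0 b0 ba x0.
have L3 : ln (x + a + n%:R) - ln (x + b + n%:R) @[n --> \oo] --> (0 : R).
  apply: (@squeeze_cvgr _ _ _ _ (fun=> 0) (fun n => (a - b) / n%:R)).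
  - near=> n.
    have n0 : (0 : R) < n%:R by near: n; exact: nbhs_infty_gtr.
    have un : 0 < x + b + n%:R by rewrite addr_gt0.
    have E : x + a + n%:R = x + b + n%:R + (a - b) by ring.
    rewrite subr_ge0 ler_ln ?posrE ?addr_gt0//; apply/andP; split; first by lra.
    rewrite E; apply: le_trans (ln_incr_le _ _ un _) _; first by lra.
    rewrite ler_pM2l ?subr_gt0// lef_pV2 ?posrE//; lra.
  - exact: cvg_cst.
  - rewrite -[X in _ --> X](mulr0 (a - b)); apply: cvgMr.
    by rewrite -cvg_shiftS; exact: cvg_harmonic.
have L4 : digamma_partial (x + a) n - digamma_partial (x + b) n -
    (ln (x + a + n%:R) - ln (x + b + n%:R)) @[n --> \oo] -->
    digamma (x + a) - digamma (x + b).
  rewrite -[X in _ --> X]subr0; apply: cvgB L3.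
  by apply: cvgB; exact: digamma_cvg.
rewrite -(cvg_lim (@Rhausdorff R) L4) /polygamma_diff.
congr (lim (_ @ \oo)); apply/funext => n /=.
have -> : polygamma_partial a b 0 x n =
    \sum_(k < n) (x + b + k%:R)^-1 - \sum_(k < n) (x + a + k%:R)^-1.
  by rewrite -sumrB; apply: eq_bigr => k _; rewrite !expr1 !addrA.
rewrite /digamma_partial.
by move: (\sum_(k < n) _) (\sum_(k < n) _) (ln _) (ln _) => *; ring.
Unshelve. all: by end_near. Qed.

(** * Normalized moments of a log-convex density *)

(** What log-convexity of f leaves on [D t = f t - A * e^(-c t)]: the set where D is
    negative is an interval. *)
Definition order_convex_neg {R : realType} (D : R -> R) : Prop :=
  forall s t u : R, 0 < s -> s < t -> t < u -> D s < 0 -> D u < 0 -> D t < 0.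

(** The interval where D is negative provides the multiplier: its endpoints are
    the roots of the quadratic if it is bounded, and the left endpoint is the root
    of the linear factor if it is not. The multiplier vanishes at the endpoints,
    where D may have either sign. *)
Lemma sign_pattern {R : realType} (D : R -> R) : order_convex_neg D ->
  (exists p q : R, [/\ 0 <= p, 0 <= q &
     forall t : R, 0 < t -> 0 <= (t ^+ 2 - q * t + p) * D t]) \/
  (exists2 s : R, 0 <= s & forall t : R, 0 < t -> (t - s) * D t <= 0).
Proof.
move=> DD; pose N := [set t : R | 0 < t /\ D t < 0].
have [N0|/set0P[n0 Nn0]] := eqVneq N set0.
  left; exists 0, 0; split=> // t t0; rewrite mul0r subr0 addr0.
  rewrite mulr_ge0 ?sqr_ge0// leNgt; apply/negP => Dt.
  by have : N t by []; rewrite N0.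
have N_lb : has_lbound N by exists 0 => t [t0 _]; exact: ltW.
have Ninf : has_inf N by split=> //; exists n0.
have i0 : 0 <= inf N by apply: lb_le_inf; [exists n0|move=> t [t0 _]; exact: ltW].
have out1 t : 0 < t -> t < inf N -> 0 <= D t.
  move=> t0 ti; rewrite leNgt; apply/negP => Dt.
  by have := ge_inf N_lb (conj t0 Dt : N t); rewrite leNgt ti.
have below t : inf N < t -> exists2 s, N s & s < t.
  rewrite -subr_gt0 => it; have [s Ns st] := inf_adherent it Ninf.
  by exists s => //; rewrite addrC subrK in st.
have [Nub|Nub] := pselect (has_ubound N); last first.
  right; exists (inf N) => // t t0.
  have [ti|ti|->] := ltgtP t (inf N); last by rewrite subrr mul0r.
    by rewrite mulr_le0_ge0 ?subr_le0 ?out1// ltW.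
  rewrite mulr_ge0_le0 ?subr_ge0 ?(ltW ti)//.
  have [s [s0 Ds] st] := below t ti.
  have [u [_ Du] tu] : exists2 u, N u & t < u.
    apply: contrapT => h; apply: Nub; exists t => u Nu.
    by rewrite leNgt; apply/negP => tu; apply: h; exists u.
  exact: ltW (DD s t u s0 st tu Ds Du).
left; exists (inf N * sup N), (inf N + sup N).
have Nsup : has_sup N by split=> //; exists n0.
have s0 : 0 <= sup N.
  by case: (Nn0) => n00 _; apply: le_trans (ltW n00) (ub_le_sup Nub Nn0).
split; [exact: mulr_ge0|exact: addr_ge0|move=> t t0].
have -> : t ^+ 2 - (inf N + sup N) * t + inf N * sup N = (t - inf N) * (t - sup N).
  by ring.
have is_ : inf N <= sup N.
  exact: le_trans (ge_inf N_lb Nn0) (ub_le_sup Nub Nn0).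
have out2 : sup N < t -> 0 <= D t.
  move=> st; rewrite leNgt; apply/negP => Dt.
  by have := ub_le_sup Nub (conj t0 Dt : N t); rewrite leNgt st.
have [ti|ti|->] := ltgtP t (inf N); last by rewrite subrr !mul0r.
  rewrite mulr_ge0 ?out1// mulr_le0// subr_le0 ltW//.
  exact: lt_le_trans is_.
have [ts|ts|->] := ltgtP t (sup N); last by rewrite subrr mulr0 mul0r.
  rewrite mulr_le0//; first by rewrite mulr_ge0_le0 ?subr_ge0 ?subr_le0 ?ltW.
  have [s [s00 Ds] st] := below t ti.
  have st0 : 0 < sup N - t by rewrite subr_gt0.
  have [u [_ Du] tu] := sup_adherent st0 Nsup.
  rewrite opprB addrC subrK in tu.
  exact: ltW (DD s t u s00 st tu Ds Du).
by rewrite mulr_ge0 ?out2// mulr_ge0// subr_ge0 ltW.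
Qed.

Lemma posint_comb {R : realType} (u v w : R -> R) (p q : R) : 0 <= p -> 0 <= q ->
  nnmeas u -> nnmeas v -> nnmeas w ->
  nnmeas (fun t => u t + (p * v t + q * w t)) /\
  posint (fun t => u t + (p * v t + q * w t)) =
    (posint u + (p%:E * posint v + q%:E * posint w))%E.
Proof.
move=> p0 q0 nu nv nw.
have npv := nnmeasM _ _ (nnmeas_cst p p0) nv.
have nqw := nnmeasM _ _ (nnmeas_cst q q0) nw.
have npq := nnmeasD _ _ npv nqw.
split; first exact: nnmeasD.
by rewrite posintD// posintD// !posintZ.
Qed.

(** Comparison with an exponential. If m(n+1)^2 > m(n) m(n+2), the mean [r] of the
    two successive moment ratios satisfies r < m(n+1)/m(n) and r^2 > m(n+2)/m(n);
    the exponential with decay rate 1/r and the same n-th moment then has a smaller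
    moment of order n+1 and a larger one of order n+2. Either multiplier of
    [sign_pattern] contradicts this. *)
Lemma log_convex_moments {R : realType} (f : R -> R) (m : nat -> R) :
  nnmeas f -> (forall n, 0 < m n) ->
  (forall n, posint (fun t => t ^+ n * f t) = (n`!%:R * m n)%:E) ->
  (forall A c : R, 0 < A -> 0 < c ->
     order_convex_neg (fun t => f t - A * expR (- (c * t)))) ->
  forall n, m n.+1 ^+ 2 <= m n * m n.+2.
Proof.
move=> nf m0 fm fD n; rewrite leNgt; apply/negP => lt.
have M0 := m0 n; have M1 := m0 n.+1; have M2 := m0 n.+2.
pose rho := m n.+1 / m n; pose sigma := m n.+2 / m n.+1.
have sr : sigma < rho.
  by rewrite /sigma /rho ltr_pdivrMr// mulrAC ltr_pdivlMr// mulrC -expr2.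
pose r := (rho + sigma) / 2.
have sigma0 : 0 < sigma by rewrite divr_gt0.
have r0 : 0 < r by rewrite /r; lra.
have c0 : 0 < r^-1 by rewrite invr_gt0.
have h1 : m n * r < m n.+1.
  by rewrite mulrC -ltr_pdivlMr// -/rho /r; lra.
have h2 : m n.+2 < m n * r ^+ 2.
  have -> : m n.+2 = m n * (rho * sigma).
    by rewrite /rho /sigma; field; rewrite !gt_eqF.
  rewrite ltr_pM2l// -subr_gt0.
  have -> : r ^+ 2 - rho * sigma = ((rho - sigma) / 2) ^+ 2 by rewrite /r; field.
  by rewrite exprn_gt0// divr_gt0// subr_gt0.
pose A := m n * r^-1 ^+ n.+1.
have A0 : 0 < A by rewrite mulr_gt0// exprn_gt0.
pose g t := A * expR (- (r^-1 * t)).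
have ng : nnmeas g by exact: nnmeasM (nnmeas_cst _ (ltW A0)) (nnmeas_expR _).
have gm k : posint (fun t => t ^+ k * g t) = (k`!%:R * (A * r ^+ k.+1))%:E.
  transitivity (posint (fun t => A * (t ^+ k * expR (- (r^-1 * t))))).
    by apply: eq_posint => t _; rewrite /g; ring.
  rewrite posintZ ?(ltW A0)//; last exact: nnmeasM (nnmeasX _) (nnmeas_expR _).
  rewrite posint_exp_moment// -EFinM; congr EFin.
  by rewrite exprVn invrK; ring.
have a0 : A * r ^+ n.+1 = m n by rewrite /A exprVn divfK// expf_neq0// gt_eqF.
have a1 : A * r ^+ n.+2 = m n * r by rewrite -a0 [in LHS]exprSr mulrA.
have a2 : A * r ^+ n.+3 = m n * r ^+ 2 by rewrite -a0 -addn2 exprD mulrA.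
have nF k : nnmeas (fun t => t ^+ k * f t) by exact: nnmeasM (nnmeasX _) nf.
have nG k : nnmeas (fun t => t ^+ k * g t) by exact: nnmeasM (nnmeasX _) ng.
have fact1 : (n.+1`!%:R : R) = n.+1%:R * n`!%:R by rewrite factS natrM.
have pf k : 0 < (k`!%:R : R) by rewrite ltr0n fact_gt0.
have [[p [q [p0 q0 hD]]]|[s s0 hD]] := sign_pattern _ (fD A _ A0 c0).
- (* Nonnegative terms are distributed on the two sides, so that only integrals
     of nonnegative functions occur. *)
  pose U t := t ^+ n.+2 * g t + (p * (t ^+ n * g t) + q * (t ^+ n.+1 * f t)).
  pose V t := t ^+ n.+2 * f t + (p * (t ^+ n * f t) + q * (t ^+ n.+1 * g t)).
  have [nU eU] := posint_comb _ _ _ p q p0 q0 (nG n.+2) (nG n) (nF n.+1).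
  have [nV eV] := posint_comb _ _ _ p q p0 q0 (nF n.+2) (nF n) (nG n.+1).
  have : (posint U <= posint V)%E.
    apply: posint_le => // t t0; rewrite -subr_ge0.
    have := mulr_ge0 (exprn_ge0 n (ltW t0)) (hD t t0); rewrite -/(g t) /U /V !exprSr.
    by congr (_ <= _); ring.
  rewrite /U /V eU eV !gm !fm -!EFinM -!EFinD lee_fin a0 a1 a2; apply/negP; rewrite -ltNge.
  rewrite ltr_leD ?ltr_pM2l// lerD2l ler_wpM2l// ler_wpM2l ?ltW//.
- pose U t := t ^+ n.+1 * f t + (s * (t ^+ n * g t) + 0 * (t ^+ n * g t)).
  pose V t := t ^+ n.+1 * g t + (s * (t ^+ n * f t) + 0 * (t ^+ n * g t)).
  have [nU eU] := posint_comb _ _ _ s 0 s0 (lexx 0) (nF n.+1) (nG n) (nG n).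
  have [nV eV] := posint_comb _ _ _ s 0 s0 (lexx 0) (nG n.+1) (nF n) (nG n).
  have : (posint U <= posint V)%E.
    apply: posint_le => // t t0; rewrite -subr_ge0 -oppr_le0.
    have := mulr_ge0_le0 (exprn_ge0 n (ltW t0)) (hD t t0); rewrite -/(g t) /U /V !exprSr.
    by congr (_ <= _); ring.
  rewrite /U /V eU eV !gm !fm -!EFinM -!EFinD lee_fin a0 a1; apply/negP; rewrite -ltNge.
  by rewrite ltrD2r ltr_pM2l.
Qed.

(** * The Laplace density *)

(** The function f of the introduction: [polygamma_diff] is the sequence of its
    moments divided by factorials. *)
Definition density {R : realType} (a b x t : R) : R :=
  (expR (- ((x + b) * t)) - expR (- ((x + a) * t))) / (1 - expR (- t)).

Lemma expRN_lt1 {R : realType} (t : R) : 0 < t -> 0 < 1 - expR (- t).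
Proof. by move=> t0; rewrite subr_gt0 expR_lt1 oppr_lt0. Qed.

Lemma expR_diff_gt0 {R : realType} (u v t : R) : u < v -> 0 < t ->
  0 < expR (- (u * t)) - expR (- (v * t)).
Proof. by move=> uv t0; rewrite subr_gt0 ltr_expR ltrN2 ltr_pM2r. Qed.

Lemma density_gt0 {R : realType} (a b x t : R) : b < a -> 0 < t ->
  0 < density a b x t.
Proof.
move=> ba t0; rewrite divr_gt0 ?expRN_lt1// expR_diff_gt0//.
by rewrite ltrD2l.
Qed.

Lemma continuous_expR_scale {R : realType} (c t : R) :
  {for t, continuous (fun s => expR (- (c * s)))}.
Proof. exact: is_derive_continuous (is_derive_expR_scale c t). Qed.

Lemma nnmeas_density {R : realType} (a b x : R) : b < a -> nnmeas (density a b x).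
Proof.
move=> ba; apply: nnmeas_continuous => t t0; last exact/ltW/density_gt0.
apply: continuousM; first by apply: continuousB; exact: continuous_expR_scale.
apply: continuousV; first by rewrite gt_eqF// expRN_lt1.
apply: continuousB; first exact: cst_continuous.
have -> : (fun s : R => expR (- s)) = (fun s => expR (- (1 * s))).
  by apply/funext => s; rewrite mul1r.
exact: continuous_expR_scale.
Qed.

Lemma posint_expR_diff {R : realType} (u v : R) (n : nat) : 0 < u -> u < v ->
  nnmeas (fun t => t ^+ n * (expR (- (u * t)) - expR (- (v * t)))) /\
  posint (fun t => t ^+ n * (expR (- (u * t)) - expR (- (v * t)))) =
    (n`!%:R * (u^-1 ^+ n.+1 - v^-1 ^+ n.+1))%:E.
Proof.
move=> u0 uv; have v0 := lt_trans u0 uv.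
set w := fun t => _; have nw : nnmeas w.
  apply: nnmeas_continuous => t t0; last first.
    by rewrite mulr_ge0 ?exprn_ge0 ?ltW ?expR_diff_gt0.
  apply: continuousM; first exact: exprn_continuous.
  by apply: continuousB; exact: continuous_expR_scale.
split=> //.
have := posintD _ _ nw (nnmeasM _ _ (nnmeasX n) (nnmeas_expR v)).
rewrite posint_exp_moment// (eq_posint _ (fun t => t ^+ n * expR (- (u * t)))); last first.
  by move=> t _; rewrite /w; ring.
rewrite posint_exp_moment// => /(congr1 (fun y => y - (n`!%:R / v ^+ n.+1)%:E)%E).
rewrite addeK// -EFinB => <-; congr EFin.
by rewrite !exprVn mulrBr.
Qed.

(** Expand 1 / (1 - e^(-t)) as a geometric series; all terms are nonnegative. *)
Lemma posint_density_moment {R : realType} (a b x : R) (n : nat) :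
  0 < b -> b < a -> 0 < x ->
  posint (fun t => t ^+ n * density a b x t) = (n`!%:R * polygamma_diff a b n x)%:E.
Proof.
move=> b0 ba x0.
have u0 (k : nat) : 0 < x + (b + k%:R) by rewrite addr_gt0// ltr_wpDr.
have uv (k : nat) : x + (b + k%:R) < x + (a + k%:R) by rewrite ltrD2l ltrD2r.
pose w (k : nat) t := t ^+ n * (expR (- ((x + (b + k%:R)) * t)) - expR (- ((x + (a + k%:R)) * t))).
pose W (N : nat) t := \sum_(k < N) w k t.
have wp k := posint_expR_diff _ _ n (u0 k) (uv k).
have Wp N : nnmeas (W N) /\ posint (W N) = (n`!%:R * polygamma_partial a b n x N)%:E.
  elim: N => [|N [IH1 IH2]].
    have -> : W 0%N = (fun=> 0) by apply/funext => t; rewrite /W big_ord0.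
    split; first exact: nnmeas_cst.
    by rewrite /polygamma_partial big_ord0 mulr0 /posint integral0.
  have -> : W N.+1 = (fun t => W N t + w N t).
    by apply/funext => t; rewrite /W big_ord_recr.
  have [w1 w2] := wp N; split; first exact: nnmeasD.
  rewrite posintD// IH2 w2 -EFinD; congr EFin.
  by rewrite -mulrDr /polygamma_partial big_ord_recr.
have WE N (t : R) : 0 < t -> W N t = t ^+ n * density a b x t * (1 - expR (- t) ^+ N).
  move=> t0; elim: N => [|N IH]; first by rewrite /W big_ord0 expr0 subrr mulr0.
  rewrite /W big_ord_recr/= -/(W N t) IH /w /density.
  have e c : expR (- ((x + (c + N%:R)) * t)) = expR (- ((x + c) * t)) * expR (- t) ^+ N.
    by rewrite -expRM_natl -expRD; congr expR; ring.
  rewrite !e exprSr; field.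
  by rewrite gt_eqF// expRN_lt1.
have L : posint (W N) @[N --> \oo] --> posint (fun t => t ^+ n * density a b x t).
  apply: posint_monotone_cvg.
  - by move=> N; have [] := Wp N.
  - move=> t t0; apply/nondecreasing_seqP => N; rewrite /W [leRHS]big_ord_recr/= lerDl.
    by rewrite mulr_ge0 ?exprn_ge0 ?ltW ?expR_diff_gt0.
  - move=> t t0; have E : W ^~ t = (fun N => t ^+ n * density a b x t * (1 - expR (- t) ^+ N)).
      by apply/funext => N; exact: WE.
    rewrite E -[X in _ --> X]mulr1; apply: cvgMr; rewrite -[X in _ --> X]subr0.
    apply: cvgB; first exact: cvg_cst.
    apply: cvg_expr; rewrite ger0_norm ?expR_ge0//.
    by rewrite expR_lt1 oppr_lt0.
rewrite -(cvg_lim (@ereal_hausdorff R) L).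
apply: cvg_lim; first exact: ereal_hausdorff.
have -> : (fun N => posint (W N)) = (fun N => (n`!%:R * polygamma_partial a b n x N)%:E).
  by apply/funext => N; have [] := Wp N.
by apply: cvg_EFin; [exact: nearW|apply: cvgMr; exact: polygamma_cvg].
Qed.

(** * Log-convexity of the density *)

(** Sublevel sets of a function with nondecreasing derivative are intervals: a
    value above the level between two values below it would force, by the mean
    value theorem, a positive slope followed by a negative one. *)
Lemma quasi_convex_of_derive {R : realType} (W dW : R -> R) (K s t u : R) :
  (forall z : R, 0 < z -> is_derive z 1 W (dW z)) ->
  (forall z z' : R, 0 < z -> z <= z' -> dW z <= dW z') ->
  0 < s -> s < t -> t < u -> W s < K -> W u < K -> W t < K.
Proof.
move=> hW hd s0 st tu Ws Wu; rewrite ltNge; apply/negP => Wt.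
have t0 := lt_trans s0 st.
have mvt p q : 0 < p -> p < q -> exists2 c, p <= c <= q & W q - W p = dW c * (q - p).
  move=> p0 pq; have [||c cpq e] := @MVT_segment R W dW p q (ltW pq).
  - by move=> z; rewrite in_itv/= => /andP[pz _]; exact: hW (lt_trans p0 pz).
  - exact: continuous_within_pos p0 hW.
  by exists c.
have [c1 /andP[c1s c1t] e1] := mvt s t s0 st.
have [c2 /andP[c2t c2u] e2] := mvt t u t0 tu.
have d1 : 0 < dW c1.
  by rewrite -(pmulr_lgt0 _ (_ : 0 < t - s)) ?subr_gt0// -e1 subr_gt0 (lt_le_trans Ws).
have d2 : dW c2 < 0.
  by rewrite -(pmulr_llt0 _ (_ : 0 < u - t)) ?subr_gt0// -e2 subr_lt0 (lt_le_trans Wu).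
have := hd c1 c2 (lt_le_trans s0 c1s) (le_trans c1t c2t).
by rewrite leNgt (lt_trans d2 d1).
Qed.

(** Both sides vanish at 0, and the derivatives compare because A + 1/A increases
    on [1, oo). This is where lambda >= 1 enters the log-convexity. *)
Lemma sinh_superlinear {R : realType} (l t : R) : 1 <= l -> 0 < t ->
  l * (expR t - expR (- t)) <= expR (l * t) - expR (- (l * t)).
Proof.
move=> l1 t0.
pose f := (fun s => expR (- (- l * s))) - (fun s => expR (- (l * s))) -
  l *: ((fun s => expR (- (- 1 * s))) - (fun s => expR (- (1 * s)))).
pose df s := - (- l * expR (- (- l * s))) - - (l * expR (- (l * s))) -
  l * (- (- 1 * expR (- (- 1 * s))) - - (1 * expR (- (1 * s)))).
have dfP (s : R) : is_derive s 1 f (df s).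
  have H1 := @is_deriveB _ _ _ _ _ _ _ _ _
    (is_derive_expR_scale (- l) s) (is_derive_expR_scale l s).
  have H2 := @is_deriveB _ _ _ _ _ _ _ _ _
    (is_derive_expR_scale (- 1) s) (is_derive_expR_scale 1 s).
  exact: (@is_deriveB _ _ _ _ _ _ _ _ _ H1 (@is_deriveZ _ _ _ _ l _ _ _ H2)).
have cf : {within `[0, t], continuous f}.
  by apply: derivable_within_continuous => s _; have [] := dfP s.
have [c cin e] := @MVT_segment R f df 0 t (ltW t0) (fun s _ => dfP s) cf.
move: cin e; rewrite in_itv/= subr0 => /andP[c0 _] e.
have f0 : f 0 = 0 by rewrite /f !fctE !mulr0 oppr0 expR0 subrr scaler0 subr0.
have ft : f t = expR (l * t) - expR (- (l * t)) - l * (expR t - expR (- t)).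
  by rewrite /f !fctE !mulNr !opprK !mul1r.
rewrite f0 subr0 in e; rewrite -subr_ge0 -ft e mulr_ge0 ?(ltW t0)//.
have -> : df c = l * (expR (l * c) + (expR (l * c))^-1 - (expR c + (expR c)^-1)).
  by rewrite /df -!expRN !mulNr !opprK !mul1r; ring.
apply: mulr_ge0; first exact: le_trans l1.
set B := expR c; set A := expR (l * c).
have B1 : 1 <= B by rewrite /B -expR0 ler_expR.
have AB : B <= A by rewrite /A /B ler_expR ler_peMl.
have B0 : 0 < B by exact: expR_gt0.
have A0 : 0 < A by exact: expR_gt0.
have -> : A + A^-1 - (B + B^-1) = (A - B) * (A * B - 1) / (A * B).
  by field; rewrite !gt_eqF.
rewrite divr_ge0 ?mulr_ge0 ?subr_ge0 ?(ltW A0) ?(ltW B0)//.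
by rewrite -[leLHS]mulr1 ler_pM// (le_trans B1).
Qed.

Definition lnterm {R : realType} (c t : R) : R := ln (1 - expR (- (c * t))).
Definition dlnterm {R : realType} (c t : R) : R := c * ((1 - expR (- (c * t)))^-1 - 1).

Lemma is_derive_one_sub_expR {R : realType} (c t : R) :
  is_derive t 1 (fun s => 1 - expR (- (c * s))) (c * expR (- (c * t))).
Proof.
have H := @is_deriveB _ _ _ (cst (1 : R)) _ t 1 0 _ (is_derive_cst _ _ _) (is_derive_expR_scale c t).
by apply: is_derive_eq; rewrite sub0r opprK.
Qed.

Lemma is_derive_lnterm {R : realType} (c t : R) : 0 < c -> 0 < t ->
  is_derive t 1 (lnterm c) (dlnterm c t).
Proof.
move=> c0 t0; have h : 0 < 1 - expR (- (c * t)) by rewrite expRN_lt1// mulr_gt0.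
have H := @is_derive1_comp _ (@ln R) _ t _ _ (is_derive1_ln h) (is_derive_one_sub_expR c t).
by apply: is_derive_eq; rewrite /dlnterm; field; rewrite gt_eqF.
Qed.

(** The derivative is minus the square of c / (2 sinh (c t / 2)), so that two values of c
    can be compared through [sinh_superlinear]. *)
Lemma is_derive_dlnterm {R : realType} (c t : R) : 0 < c -> 0 < t ->
  is_derive t 1 (dlnterm c) (- (c / (expR (c * (t / 2)) - expR (- (c * (t / 2))))) ^+ 2).
Proof.
move=> c0 t0; have h : 0 < 1 - expR (- (c * t)) by rewrite expRN_lt1// mulr_gt0.
have hn : 1 - expR (- (c * t)) != 0 by rewrite gt_eqF.
have H1 := @is_deriveV _ _ t _ _ hn (is_derive_one_sub_expR c t).
have H2 := @is_deriveB _ _ _ _ (cst (1 : R)) t 1 _ 0 H1 (is_derive_cst _ _ _).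
have H3 := @is_deriveZ _ _ _ _ c t 1 _ H2.
apply: is_derive_eq; rewrite subr0 /GRing.scale/=.
have e : expR (- (c * t)) = expR (- (c * (t / 2))) ^+ 2.
  by rewrite -expRM_natl; congr expR; field.
have ei : expR (c * (t / 2)) = (expR (- (c * (t / 2))))^-1 by rewrite expRN invrK.
move: hn; rewrite e ei; set q := expR _ => hn.
have q0 : q != 0 by rewrite gt_eqF// expR_gt0.
by field; rewrite q0 mulNr -expr2 hn.
Qed.

Lemma dlnterm_diff_nd {R : realType} (l : R) (z z' : R) : 1 <= l -> 0 < z -> z <= z' ->
  dlnterm l z - dlnterm 1 z <= dlnterm l z' - dlnterm 1 z'.
Proof.
move=> l1 z0 zz'; have l0 : 0 < l by exact: lt_le_trans l1.
pose f := dlnterm l - dlnterm 1.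
pose S c (t : R) := expR (c * (t / 2)) - expR (- (c * (t / 2))).
pose df t := - (l / S l t) ^+ 2 - - (1 / S 1 t) ^+ 2.
have dfP (t : R) : 0 < t -> is_derive t 1 f (df t).
  by move=> t0; exact: (@is_deriveB _ _ _ _ _ _ _ _ _
    (is_derive_dlnterm l t l0 t0) (is_derive_dlnterm 1 t ltr01 t0)).
have [||c cin e] := @MVT_segment R f df z z' zz'.
- by move=> s; rewrite in_itv/= => /andP[zs _]; apply: dfP; exact: lt_trans zs.
- exact: continuous_within_pos z0 dfP.
move: cin; rewrite in_itv/= => /andP[zc _].
have c0 : 0 < c by exact: lt_le_trans zc.
rewrite -subr_ge0 -/(f z) -/(f z').
rewrite (_ : _ - _ = f z' - f z)// e; apply: mulr_ge0; last by rewrite subr_ge0.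
rewrite /df opprK addrC subr_ge0.
have S0 k : 0 < k -> 0 < S k c.
  by move=> k0; rewrite /S subr_gt0 ltr_expR gtrN// mulr_gt0// divr_gt0.
have Sl := S0 l l0; have S1 := S0 1 ltr01.
have sl : l * S 1 c <= S l c.
  by have := sinh_superlinear l (c / 2) l1 (divr_gt0 c0 (ltr0Sn R 1)); rewrite /S !mul1r.
apply: lerXn2r; rewrite ?nnegrE ?divr_ge0 ?(ltW l0) ?(ltW Sl) ?(ltW S1)//.
by rewrite ler_pdivrMr// mulrAC ler_pdivlMr// mul1r.
Qed.

(** Taking logarithms turns [density < A e^(-c t)] into a bound on the convex
    function ln (1 - e^(-(a-b) t)) - ln (1 - e^(-t)) plus a linear term. *)
Lemma density_order_convex {R : realType} (a b x A c : R) : b <= a - 1 -> 0 < A ->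
  order_convex_neg (fun t => density a b x t - A * expR (- (c * t))).
Proof.
move=> ba A0 s t u s0 st tu.
have l1 : 1 <= a - b by lra.
have l0 : 0 < a - b by exact: lt_le_trans l1.
pose W := lnterm (a - b) - lnterm 1 + (fun t : R => 0 + (t - 0) * (c - (x + b))).
pose dW z := dlnterm (a - b) z - dlnterm 1 z + (c - (x + b)).
have WP (z : R) : 0 < z -> is_derive z 1 W (dW z).
  move=> z0; have H := @is_deriveB _ _ _ _ _ _ _ _ _
    (is_derive_lnterm (a - b) z l0 z0) (is_derive_lnterm 1 z ltr01 z0).
  exact: (@is_deriveD _ _ _ _ _ _ _ _ _ H (is_derive_affine 0 (c - (x + b)) 0 z)).
have key (z : R) : 0 < z -> (density a b x z - A * expR (- (c * z)) < 0) = (W z < ln A).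
  move=> z0; have p1 : 0 < 1 - expR (- ((a - b) * z)) by rewrite expRN_lt1// mulr_gt0.
  have p2 : 0 < 1 - expR (- (1 * z)) by rewrite mul1r expRN_lt1.
  have -> : density a b x z = expR (- ((x + b) * z)) *
     ((1 - expR (- ((a - b) * z))) / (1 - expR (- (1 * z)))).
    rewrite /density mul1r mulrA mulrBr mulr1 -expRD.
    by congr ((_ - expR _) / _); ring.
  rewrite subr_lt0 -ltr_ln ?posrE ?mulr_gt0 ?invr_gt0 ?expR_gt0//.
  rewrite !lnM ?posrE ?divr_gt0 ?invr_gt0 ?expR_gt0// lnV ?posrE// !expRK.
  have -> : W z = lnterm (a - b) z - lnterm 1 z + (c - (x + b)) * z.
    by rewrite /W !fctE add0r subr0 [X in _ + X]mulrC.
  rewrite -/(lnterm (a - b) z) -/(lnterm 1 z) -subr_gt0 -[RHS]subr_gt0.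
  by congr (0 < _); ring.
have t0 := lt_trans s0 st; have u0 := lt_trans t0 tu.
rewrite !key//.
apply: (quasi_convex_of_derive W dW) => // z z' z0 zz'.
by rewrite lerD2r dlnterm_diff_nd.
Qed.

(** * The generalized Bernstein property *)

Lemma signed_jet_derivative {R : realType} (c : nat -> R -> R) :
  signed_jet c -> signed_jet (fun n x => - (n.+1%:R * c n.+1 x)).
Proof.
move=> jc n x x0.
have H := @is_deriveN _ _ _ _ _ _ _ (@is_deriveZ _ _ _ _ n.+1%:R _ _ _ (jc n.+1 x x0)).
by apply: is_derive_eq; rewrite /GRing.scale/=; ring.
Qed.

Lemma signed_jet_comb {R : realType} (k : R) (c d : nat -> R -> R) :
  signed_jet c -> signed_jet d -> signed_jet (fun n x => k * c n x + d n x).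
Proof.
move=> jc jd n x x0.
have H := @is_deriveD _ _ _ _ _ _ _ _ _ (@is_deriveZ _ _ _ _ k _ _ _ (jc n x x0)) (jd n x x0).
by apply: is_derive_eq; rewrite /GRing.scale/=; ring.
Qed.

Lemma signed_jet_inv {R : realType} : signed_jet (fun n (x : R) => x^-1 ^+ n.+1).
Proof.
move=> n x x0; have x00 : x + 0 != 0 by rewrite addr0 gt_eqF.
have := @is_derive_invX R 0 n x x00; rewrite addr0.
by apply: is_derive_eq_pos => // y _; rewrite addr0.
Qed.

(** These are (-1)^n binom(mu, n). *)
Fixpoint powR_jet_coef {R : realType} (mu : R) (n : nat) : R :=
  if n is m.+1 then - ((mu - m%:R) / m.+1%:R * powR_jet_coef mu m) else 1.

Lemma signed_jet_powR {R : realType} (mu : R) :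
  signed_jet (fun n x => powR_jet_coef mu n * x `^ (mu - n%:R)).
Proof.
move=> n x x0.
have H := @is_deriveZ _ _ _ _ (powR_jet_coef mu n) _ _ _ (is_derive1_powR (mu - n%:R) x0).
apply: is_derive_eq; rewrite /GRing.scale/=.
have -> : mu - n%:R - 1 = mu - n.+1%:R by rewrite -natr1; ring.
have n0 : (n.+1%:R : R) != 0 by rewrite pnatr_eq0.
by move: (n.+1%:R : R) n0 => d d0 /=; field.
Qed.

Lemma completely_monotonic_jet {R : realType} (c : nat -> R -> R) (g : R -> R) :
  signed_jet c -> (forall x, 0 < x -> g x = c 0%N x) ->
  (forall n x, 0 < x -> 0 <= c n x) -> completely_monotonic g.
Proof.
move=> jc gc c0; split=> n x x0; have [D E] := signed_jet_derive1n c g jc gc n x x0.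
  by [].
by rewrite E mulr_ge0// c0.
Qed.

Lemma polygamma_diff_log_convex {R : realType} (a b x : R) :
  0 < b -> b < a - 1 -> 0 < x ->
  forall n, polygamma_diff a b n.+1 x ^+ 2 <= polygamma_diff a b n x * polygamma_diff a b n.+2 x.
Proof.
move=> b0 ba1 x0; have ba : b < a by lra.
apply: (log_convex_moments (density a b x) (fun n => polygamma_diff a b n x)).
- exact: nnmeas_density.
- by move=> n; exact: polygamma_diff_gt0.
- by move=> n; exact: posint_density_moment.
- by move=> A c A0 c0; apply: density_order_convex => //; exact: ltW.
Qed.

(** Boundedness of [c n * x ^+ n] comes from [polygamma_diff_le] and
    x <= x + b. *)
Lemma polygamma_diff_decay {R : realType} (a b x : R) :
  0 < b -> b < a - 1 -> 0 < x ->
  forall n, x * polygamma_diff a b n.+1 x <= polygamma_diff a b n x.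
Proof.
move=> b0 ba1 x0; have ba : b < a by lra.
apply: (log_convex_decay (fun n => polygamma_diff a b n x) x ((Num.bound (a - b))%:R * x^-1)) => //.
- by move=> n; exact: polygamma_diff_gt0.
- exact: polygamma_diff_log_convex.
move=> n; have xb : x <= x + b by rewrite lerDl ltW.
have xn : 0 < x ^+ n by rewrite exprn_gt0.
rewrite -ler_pdivlMr// -mulrA -invfM -exprS -exprVn.
apply: le_trans (polygamma_diff_le a b x n b0 ba x0) _.
by rewrite ler_wpM2l// invX_le.
Qed.

Theorem corollary5p13 (R : realType) (a b : R) (hb : 0 < b) (hba : b < a - 1) :
  generalized_Bernstein (a - b) (F_ab a b).
Proof.
have ba : b < a by lra.
pose c := polygamma_diff a b.
have jc : signed_jet c by exact: signed_jet_polygamma_diff.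
have c0 n x : 0 < x -> 0 < c n x by exact: polygamma_diff_gt0.
pose v n x := conv_inverse (c ^~ x) n.
have cn0 x : 0 < x -> c 0%N x != 0 by move=> x0; rewrite gt_eqF// c0.
have jv : signed_jet v by exact: signed_jet_inverse.
have v0 x : 0 < x -> v 0%N x * c 0%N x = 1 by move=> x0; exact/conv_inverse0/cn0.
have vc x : 0 < x -> forall n, \sum_(k < n.+2) v k x * c (n.+1 - k)%N x = 0.
  by move=> x0 n; exact: (conv_inverseP (c ^~ x) n (cn0 x x0)).
have v00 x : 0 < x -> 0 < v 0%N x by move=> x0; rewrite /v /conv_inverse/= invr_gt0 c0.
have vle n x : 0 < x -> v n.+1 x <= 0.
  move=> x0; apply: (kaluza (c ^~ x) (v ^~ x)) => //.
  - by move=> m; exact: c0.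
  - exact: polygamma_diff_log_convex.
  - exact: v0.
  - exact: vc.
pose q n x := \sum_(k < n.+1) v k x * x^-1 ^+ (n - k).+1.
have jq : signed_jet q by exact: signed_jet_conv jv signed_jet_inv.
have qge n x : 0 < x -> 0 <= q n x.
  move=> x0; apply: (inverse_partial_sum_ge0 (c ^~ x) (v ^~ x) x x0).
  - by move=> m; exact: c0.
  - exact: polygamma_diff_decay.
  - exact: v0.
  - by move=> m; exact: vle.
  - exact: vc.
pose mu := a - b - 1.
pose P n x := \sum_(k < n.+1) (powR_jet_coef mu k * x `^ (mu - k%:R)) * v (n - k)%N x.
have jP : signed_jet P by exact: signed_jet_conv (signed_jet_powR mu) jv.
have FE x : 0 < x -> F_ab a b x = x `^ mu * v 0%N x.
  by move=> x0; rewrite /F_ab digamma_diff.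
have FP x : 0 < x -> F_ab a b x = P 0%N x.
  by move=> x0; rewrite FE// /P big_ord1/= mul1r subr0.
have dF := signed_jet_derive1n P (F_ab a b) jP FP.
split.
- by move=> x x0; rewrite FE// mulr_gt0 ?powR_gt0// v00.
- by move=> n x x0; have [] := dF n x x0.
apply: (completely_monotonic_jet (fun n x => mu * q n x + - (n.+1%:R * v n.+1 x))).
- exact: signed_jet_comb jq (signed_jet_derivative v jv).
- move=> x x0; have [_] := dF 1%N x x0.
  rewrite derive1n1 expr1 mulN1r factS fact0 muln1 mul1r => /(congr1 -%R); rewrite opprK => ->.
  rewrite /P /q big_ord_recl big_ord1 big_ord1/= !mul1r expr1 subr0 mulr1.
  have xn : x != 0 by rewrite gt_eqF.
  have -> : x `^ (mu - 1) = x `^ mu / x.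
    by rewrite powRB ?powRr1 ?ltW// xn implybT.
  have -> : x `^ (1 - (a - b)) = (x `^ mu)^-1.
    by rewrite -powRN; congr (_ `^ _); rewrite /mu; ring.
  by field; rewrite xn gt_eqF// powR_gt0.
- move=> n x x0; apply: addr_ge0; first by rewrite mulr_ge0 ?qge// /mu; lra.
  by rewrite oppr_ge0 mulr_ge0_le0 ?vle.
Qed.
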